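(* Let $\alpha:[0,1]\to\mathbf{R}^2$ be a path. Then $\alpha$ is rectifiable if and only if it has finite variation in every direction.
   Context: The setting is Bishop-style constructive mathematics (intuitionistic logic). A statement that a supremum of a set $S$ of reals ''exists'' (is a real number) means that there is a real number $s$ that is an upper bound of $S$ and such that for each $\varepsilon>0$ there is $x\in S$ with $x>s-\varepsilon$. A path in a metric space $(X,\rho)$ is a continuous function from $[0,1]$ into $X$; $\mathbf{R}^2$ carries the Euclidean metric. A partition $P$ of $[0,1]$ is a finite sequence $0=x_0\leqslant x_1\leqslant\cdots\leqslant x_n=1$. For a path $\alpha$ and a partition $P$, put $l_P(\alpha)=\sum_{i=0}^{n-1}\rho(\alpha(x_i),\alpha(x_{i+1}))$. The length of $\alpha$ is $l(\alpha)=\sup_P l_P(\alpha)$, the supremum over all partitions $P$ of $[0,1]$. The path $\alpha$ is rectifiable if $l(\alpha)$ exists, i.e. is a real number. For $w\in\mathbf{R}^2\setminus\{0\}$ let $\pi_w$ be the standard (orthogonal) projection of $\mathbf{R}^2$ onto $\mathbf{R}w$. The variation of $\alpha:[0,1]\to\mathbf{R}^2$ along $w$ is $v_w(\alpha)=l(\pi_w\circ\alpha)$. For $\theta\in\mathbf{R}$, $v_\theta(\alpha)$ denotes $v_w(\alpha)$ with $w=(\cos\theta,\sin\theta)$. A path $\alpha$ in $\mathbf{R}^2$ has finite variation in every direction if $v_\theta(\alpha)$ exists (is a real number) for all $\theta\in\mathbf{R}$. *)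

(* Defs.v *)
(* Bishop-style mathematics over an arbitrary model R of the constructive reals of
   the standard library. Existence is Set/Type-valued throughout, so that an
   existence proof is a construction, and no excluded middle, choice or
   extensionality axiom is assumed. Equality of reals is CReq. *)

From Stdlib Require Export QArith.
From Stdlib Require Export ConstructiveReals ConstructiveAbs ConstructiveLimits
  ConstructivePower ConstructiveSum.
From Stdlib Require Export CRelationClasses.
From Stdlib Require Import ZArith Qabs Arith Factorial Lia Setoid Morphisms Ring.

#[local] Open Scope ConstructiveReals.

Lemma CRring_theory (R : ConstructiveReals) :
  ring_theory (CR_of_Q R 0) (CR_of_Q R 1) (CRplus R) (CRmult R) (CRminus R)
    (CRopp R) (CReq R).
Proof. exact (CRisRing R). Qed.

Lemma CRsetoid_theory (R : ConstructiveReals) : Setoid_Theory (CRcarrier R) (CReq R).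
Proof. exact CReq_rel. Qed.

Section Facts.

Context {R : ConstructiveReals}.
Implicit Types x y a b u K : CRcarrier R.

Add Ring CRring : (CRring_theory R)
  (setoid (CRsetoid_theory R) (CRisRingExt R)).

Lemma CRle_of_minus x y : 0 <= y - x -> x <= y.
Proof.
  intro H. apply (CRplus_le_reg_r (- x)).
  rewrite CRplus_opp_r. exact H.
Qed.

Lemma CRsquare_le a b : 0 <= a -> a <= b -> a * a <= b * b.
Proof.
  intros Ha Hab. apply (CRle_trans _ (a * b)).
  - apply CRmult_le_compat_l; assumption.
  - apply CRmult_le_compat_r; [|assumption]. now apply (CRle_trans _ a).
Qed.

Lemma CRhalf_pow_ge_0 n : 0 <= CRpow (CR_of_Q R (1#2)) n.
Proof.
  apply CRpow_ge_zero, CR_of_Q_le. discriminate.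
Qed.

Lemma CRhalf_pow_le n m : (n <= m)%nat ->
  CRpow (CR_of_Q R (1#2)) m <= CRpow (CR_of_Q R (1#2)) n.
Proof.
  induction 1 as [|m _ IH]. { apply CRle_refl. }
  apply (CRle_trans _ (1 * CRpow (CR_of_Q R (1#2)) m)).
  - apply CRmult_le_compat_r. { apply CRhalf_pow_ge_0. }
    apply CR_of_Q_le. discriminate.
  - rewrite CRmult_1_l. exact IH.
Qed.

Lemma CRgeo_small u K :
  (forall n, u <= CRpow (CR_of_Q R (1#2)) n * K) -> u <= 0.
Proof.
  intro H. apply (CR_cv_bound_down (fun n => CRpow (CR_of_Q R (1#2)) n * K) u 0 0).
  - intros; apply H.
  - apply (CR_cv_proper _ (0 * K)). { apply CR_cv_scale, GeoCvZero. } apply CRmult_0_l.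
Qed.

(* Brackets of the square root. They are shrunk by trisection: of two distinct
   points, either the square of the first is below x or the square of the second
   is above x, whereas no such decision is available at a midpoint. *)
Definition CRsqrt_bracket x a b : Set := prod (a < b) (0 <= a /\ a * a <= x /\ x <= b * b).

Local Notation third := (CR_of_Q R (1#3)).

Lemma CRthird : 1 - third - third == third.
Proof.
  unfold CRminus. rewrite <- CR_of_Q_opp, <- !CR_of_Q_plus.
  apply CR_of_Q_morph. reflexivity.
Qed.

Lemma CRtrisect x a b : CRsqrt_bracket x a b ->
  { cd : CRcarrier R * CRcarrier R & prod (CRsqrt_bracket x (fst cd) (snd cd))
      (a <= fst cd /\ snd cd <= b
       /\ snd cd - fst cd == (b - a) * (1 - third)) }.
Proof.
  intros [Hlt (Ha & Hax & Hxb)].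
  assert (Ht : 0 < third). { apply CR_of_Q_lt. reflexivity. }
  assert (Hw : 0 < (b - a) * third).
  { apply CRmult_lt_0_compat; [|exact Ht]. now apply CRlt_minus. }
  set (c := a + (b - a) * third). set (d := b - (b - a) * third).
  assert (Hac : a <= c). { apply Rplus_le_pos, CRlt_asym, Hw. }
  assert (Hdb : d <= b).
  { apply CRle_of_minus. unfold d.
    setoid_replace (b - (b - (b - a) * third)) with ((b - a) * third) by ring.
    now apply CRlt_asym. }
  assert (Hac' : a < c).
  { unfold c. rewrite <- (CRplus_0_r a) at 1. now apply CRplus_lt_compat_l. }
  assert (Hcd : c < d).
  { apply (CRplus_lt_reg_r (- c)). rewrite CRplus_opp_r.
    setoid_replace (d + - c) with ((b - a) * (1 - third - third))
      by (unfold c, d; ring).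
    rewrite CRthird. exact Hw. }
  assert (Hcc : c * c < d * d).
  { assert (Hc : 0 < c) by (now apply (CRle_lt_trans _ a)).
    apply (CRlt_trans _ (c * d)).
    - now apply CRmult_lt_compat_l.
    - apply CRmult_lt_compat_r; [|exact Hcd]. now apply (CRlt_trans _ c). }
  destruct (snd (CRltLinear R) _ x _ Hcc) as [H|H].
  - exists (c, b). split; [split|split; [|split]]; simpl.
    + now apply (CRlt_le_trans _ d).
    + split; [now apply (CRle_trans _ a)|]. split; [now apply CRlt_asym|exact Hxb].
    + exact Hac.
    + apply CRle_refl.
    + unfold c. ring.
  - exists (a, d). split; [split|split; [|split]]; simpl.
    + now apply (CRlt_trans _ c).
    + split; [exact Ha|]. split; [exact Hax|now apply CRlt_asym].
    + apply CRle_refl.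
    + exact Hdb.
    + unfold d. ring.
Qed.

Lemma CRbracket_halve x a b : CRsqrt_bracket x a b ->
  { cd : CRcarrier R * CRcarrier R & prod (CRsqrt_bracket x (fst cd) (snd cd))
      (a <= fst cd /\ snd cd <= b
       /\ snd cd - fst cd <= CR_of_Q R (1#2) * (b - a)) }.
Proof.
  intro H. destruct (CRtrisect x a b H) as [[c d] [Hcd (Hac & Hdb & Hw)]]; simpl in *.
  destruct (CRtrisect x c d Hcd) as [[e f] [Hef (Hce & Hfd & Hw')]]; simpl in *.
  exists (e, f); simpl. split; [exact Hef|]. split; [|split].
  - now apply (CRle_trans _ c).
  - now apply (CRle_trans _ d).
  - rewrite Hw', Hw.
    setoid_replace ((b - a) * (1 - third) * (1 - third))
      with ((1 - third) * (1 - third) * (b - a)) by ring.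
    apply CRmult_le_compat_r.
    + apply CRle_minus, CRlt_asym, (fst H).
    + unfold CRminus.
      rewrite <- CR_of_Q_opp, <- !CR_of_Q_plus, <- CR_of_Q_mult.
      apply CR_of_Q_le. discriminate.
Qed.

Lemma CRsqrt_exists x : 0 <= x -> { y : CRcarrier R | 0 <= y /\ y * y == x }.
Proof.
  intro Hx.
  assert (H0 : CRsqrt_bracket x 0 (x + 1)).
  { split; [|split; [apply CRle_refl|split]].
    - apply (CRle_lt_trans _ x _ Hx). rewrite <- (CRplus_0_r x) at 1.
      apply CRplus_lt_compat_l, CRzero_lt_one.
    - rewrite CRmult_0_l. exact Hx.
    - apply CRle_of_minus.
      setoid_replace ((x + 1) * (x + 1) - x) with (x * x + x + 1) by ring.
      apply (CRle_trans _ (0 + 0 + 0)). { rewrite !CRplus_0_l. apply CRle_refl. }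
      apply CRplus_le_compat; [|apply CRlt_asym, CRzero_lt_one].
      apply CRplus_le_compat; [|exact Hx]. now apply CRmult_le_0_compat. }
  pose (T := { ab : CRcarrier R * CRcarrier R & CRsqrt_bracket x (fst ab) (snd ab) }).
  pose (next := fun t : T =>
    let s := CRbracket_halve x _ _ (projT2 t) in
    existT (fun ab => CRsqrt_bracket x (fst ab) (snd ab)) (projT1 s) (fst (projT2 s)) : T).
  pose (seq := fix seq n : T :=
    match n with
    | O => existT _ (0, x + 1) H0
    | S n => next (seq n)
    end).
  pose (lo := fun n => fst (projT1 (seq n))). pose (hi := fun n => snd (projT1 (seq n))).
  assert (Hstep : forall n, lo n <= lo (S n) /\ hi (S n) <= hi n
      /\ hi (S n) - lo (S n) <= CR_of_Q R (1#2) * (hi n - lo n)).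
  { intro n. exact (snd (projT2 (CRbracket_halve x _ _ (projT2 (seq n))))). }
  assert (Hbr : forall n, lo n <= hi n /\ 0 <= lo n /\ lo n * lo n <= x
      /\ x <= hi n * hi n).
  { intro n. destruct (projT2 (seq n)) as [H1 H2]. split; [|exact H2].
    now apply CRlt_asym. }
  assert (Hw : forall n, hi n - lo n <= CRpow (CR_of_Q R (1#2)) n * (x + 1)).
  { induction n.
    - simpl. rewrite CRmult_1_l. unfold hi, lo; simpl.
      setoid_replace (x + 1 - 0) with (x + 1) by ring. apply CRle_refl.
    - apply (CRle_trans _ (CR_of_Q R (1#2) * (hi n - lo n))). { apply Hstep. }
      simpl. rewrite CRmult_assoc. apply CRmult_le_compat_l; [|exact IHn].
      apply CR_of_Q_le. discriminate. }
  assert (Hlo : forall n p, (n <= p)%nat -> lo n <= lo p).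
  { induction 1. { apply CRle_refl. }
    apply (CRle_trans _ (lo m)); [assumption|apply Hstep]. }
  assert (Hhi : forall n p, (n <= p)%nat -> hi p <= hi n).
  { induction 1. { apply CRle_refl. }
    apply (CRle_trans _ (hi m)); [apply Hstep|assumption]. }
  assert (Hcau : CR_cauchy R lo).
  { intro p.
    assert (Hcv : CR_cv R (fun n => CRpow (CR_of_Q R (1#2)) n * (x + 1)) 0).
    { apply (CR_cv_proper _ (0 * (x + 1))). { apply CR_cv_scale, GeoCvZero. }
      apply CRmult_0_l. }
    destruct (Hcv p) as [n Hn]. exists n. intros i j Hi Hj.
    apply (CRle_trans _ (hi n - lo n)).
    - apply CRabs_le. split; apply CRle_of_minus.
      + setoid_replace (lo i - lo j - - (hi n - lo n))
          with ((hi n - lo j) + (lo i - lo n)) by ring.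
        rewrite <- (CRplus_0_r 0). apply CRplus_le_compat; apply CRle_minus.
        * apply (CRle_trans _ (hi j)); [apply Hbr|now apply Hhi].
        * now apply Hlo.
      + setoid_replace (hi n - lo n - (lo i - lo j))
          with ((hi n - lo i) + (lo j - lo n)) by ring.
        rewrite <- (CRplus_0_r 0). apply CRplus_le_compat; apply CRle_minus.
        * apply (CRle_trans _ (hi i)); [apply Hbr|now apply Hhi].
        * now apply Hlo.
    - apply (CRle_trans _ _ _ (Hw n)). specialize (Hn n (le_n n)).
      refine (CRle_trans _ _ _ _ Hn).
      setoid_replace (CRpow (CR_of_Q R (1#2)) n * (x + 1) - 0)
        with (CRpow (CR_of_Q R (1#2)) n * (x + 1)) by ring.
      apply CRle_abs. }
  destruct (CR_complete R lo Hcau) as [l Hl].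
  assert (Hll : forall n, lo n <= l).
  { apply growing_ineq; [|exact Hl]. intro n. apply Hstep. }
  assert (Hlh : forall n, l <= hi n).
  { intro n. apply (CR_cv_bound_up lo (hi n) l n); [|exact Hl].
    intros p Hp. apply (CRle_trans _ (hi p)); [apply Hbr|now apply Hhi]. }
  assert (Hl0 : 0 <= l). { apply (CRle_trans _ (lo O)); [apply Hbr|apply Hll]. }
  assert (Hsq : forall n, hi n * hi n - lo n * lo n
      <= CRpow (CR_of_Q R (1#2)) n * ((x + 1) * (2 * (x + 1)))).
  { intro n. rewrite <- CRmult_assoc.
    setoid_replace (hi n * hi n - lo n * lo n)
      with ((hi n - lo n) * (hi n + lo n)) by ring.
    apply (CRle_trans _ ((hi n - lo n) * (2 * (x + 1)))).
    - apply CRmult_le_compat_l. { apply CRle_minus, Hbr. }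
      rewrite CR_double.
      assert (hi n <= x + 1) by (apply (Hhi O n), Nat.le_0_l).
      apply CRplus_le_compat; [assumption|].
      apply (CRle_trans _ (hi n)); [apply Hbr|assumption].
    - apply CRmult_le_compat_r; [|apply Hw].
      apply CRmult_le_0_compat. { apply CR_of_Q_le. discriminate. }
      apply CRlt_asym, (fst H0). }
  exists l. split; [exact Hl0|]. split; apply CRle_of_minus.
  - setoid_replace (l * l - x) with (- (x - l * l)) by ring.
    rewrite <- CRopp_0. apply CRopp_ge_le_contravar.
    apply (CRgeo_small _ ((x + 1) * (2 * (x + 1)))). intro n.
    apply (CRle_trans _ _ _ (CRplus_le_compat _ _ _ _ (proj2 (proj2 (proj2 (Hbr n))))
      (CRopp_ge_le_contravar _ _ (CRsquare_le _ _ (proj1 (proj2 (Hbr n))) (Hll n))))).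
    apply Hsq.
  - setoid_replace (x - l * l) with (- (l * l - x)) by ring.
    rewrite <- CRopp_0. apply CRopp_ge_le_contravar.
    apply (CRgeo_small _ ((x + 1) * (2 * (x + 1)))). intro n.
    apply (CRle_trans _ _ _ (CRplus_le_compat _ _ _ _ (CRsquare_le _ _ Hl0 (Hlh n))
      (CRopp_ge_le_contravar _ _ (proj1 (proj2 (proj2 (Hbr n))))))).
    apply Hsq.
Qed.

Definition CRsqrt x (Hx : 0 <= x) : CRcarrier R := proj1_sig (CRsqrt_exists x Hx).

Definition CRexp_term x (n : nat) : CRcarrier R :=
  CR_of_Q R (1 # Pos.of_nat (fact n)) * CRpow x n.

Lemma CRexp_term_0 x : CRexp_term x 0 == 1.
Proof. unfold CRexp_term. simpl. apply CRmult_1_l. Qed.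

Lemma Zpos_of_nat n : n <> O -> Z.pos (Pos.of_nat n) = Z.of_nat n.
Proof. intro H. rewrite <- positive_nat_Z, Nat2Pos.id; [reflexivity|exact H]. Qed.

Lemma CRexp_term_S x n : INR (S n) * CRexp_term x (S n) == x * CRexp_term x n.
Proof.
  unfold CRexp_term, INR.
  assert (E : CR_of_Q R (1 # Pos.of_nat (fact n)) ==
      CR_of_Q R (Z.of_nat (S n) # 1) * CR_of_Q R (1 # Pos.of_nat (fact (S n)))).
  { rewrite <- CR_of_Q_mult. apply CR_of_Q_morph. unfold Qeq.
    change (Qnum ((Z.of_nat (S n) # 1) * (1 # Pos.of_nat (fact (S n)))))
      with (Z.of_nat (S n) * 1)%Z.
    change (Qden ((Z.of_nat (S n) # 1) * (1 # Pos.of_nat (fact (S n)))))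
      with (Pos.of_nat (fact (S n))).
    change (Qnum (1 # Pos.of_nat (fact n))) with 1%Z.
    change (Qden (1 # Pos.of_nat (fact n))) with (Pos.of_nat (fact n)).
    rewrite !Zpos_of_nat by apply fact_neq_0.
    change (fact (S n)) with (S n * fact n)%nat. lia. }
  rewrite E. simpl CRpow. ring.
Qed.

Lemma pow_le_fact m n : (S m ^ n <= S m ^ S m * fact n)%nat.
Proof.
  destruct (Nat.le_gt_cases n (S m)) as [H|H].
  - apply (Nat.le_trans _ (S m ^ S m)). { apply Nat.pow_le_mono_r; lia. }
    assert (H1 := lt_O_fact n). nia.
  - apply Nat.lt_le_incl in H. induction H as [|n H IH].
    + assert (H1 := lt_O_fact (S m)). nia.
    + change (fact (S n)) with (S n * fact n)%nat.
      rewrite Nat.pow_succ_r'. nia.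
Qed.

#[local] Instance CRpow_morph : Proper (CReq R ==> eq ==> CReq R) CRpow.
Proof. intros x y Hxy n _ <-. now apply CRpow_proper. Qed.

Lemma CRpow_abs x n : CRabs R (CRpow x n) == CRpow (CRabs R x) n.
Proof.
  induction n as [|n IH].
  - simpl. apply CRabs_right, CRlt_asym, CRzero_lt_one.
  - simpl. now rewrite CRabs_mult, IH.
Qed.

Lemma CRpow_le x y n : 0 <= x -> x <= y -> CRpow x n <= CRpow y n.
Proof.
  intros Hx Hxy. induction n as [|n IH]. { apply CRle_refl. }
  simpl. apply (CRle_trans _ (x * CRpow y n)).
  - now apply CRmult_le_compat_l.
  - apply CRmult_le_compat_r; [|exact Hxy].
    apply CRpow_ge_zero. now apply (CRle_trans _ x).
Qed.

Lemma CRexp_term_bound x :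
  { K : CRcarrier R | 0 <= K /\
      forall n, CRabs R (CRexp_term x n) <= CRpow (CR_of_Q R (1#2)) n * K }.
Proof.
  destruct (CRup_nat (2 * CRabs R x)) as [M HM].
  exists (INR (S M ^ S M)). split. { apply CR_of_Q_le. unfold Qle; simpl; lia. }
  intro n. unfold CRexp_term. rewrite CRabs_mult, CRpow_abs.
  rewrite (CRabs_right (CR_of_Q R _)) by (apply CR_of_Q_le; discriminate).
  apply (CRle_trans _ (CR_of_Q R (1 # Pos.of_nat (fact n))
      * CRpow (CR_of_Q R (1#2) * INR (S M)) n)).
  - apply CRmult_le_compat_l. { apply CR_of_Q_le. discriminate. }
    apply CRpow_le. { apply CRabs_pos. }
    apply (CRmult_le_reg_l 2). { apply CR_of_Q_lt. reflexivity. }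
    apply (CRle_trans _ _ _ (CRlt_asym _ _ HM)).
    unfold INR. rewrite <- !CR_of_Q_mult. apply CR_of_Q_le. unfold Qle, Qmult.
    simpl Qnum; simpl Qden. lia.
  - rewrite <- CRpow_mult.
    setoid_replace (CR_of_Q R (1 # Pos.of_nat (fact n))
        * (CRpow (CR_of_Q R (1#2)) n * CRpow (INR (S M)) n))
      with (CRpow (CR_of_Q R (1#2)) n
        * (CR_of_Q R (1 # Pos.of_nat (fact n)) * CRpow (INR (S M)) n)) by ring.
    apply CRmult_le_compat_l. { apply CRhalf_pow_ge_0. }
    assert (E : CRpow (INR (S M)) n == @INR R (S M ^ n)).
    { clear. induction n as [|n IH]. { reflexivity. }
      simpl CRpow. rewrite IH, Nat.pow_succ_r'. unfold INR.
      rewrite <- CR_of_Q_mult. apply CR_of_Q_morph.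
      rewrite Nat2Z.inj_mul. reflexivity. }
    rewrite E. unfold INR. rewrite <- CR_of_Q_mult. apply CR_of_Q_le.
    unfold Qle.
    change (1 * Z.of_nat (S M ^ n) * 1
        <= Z.of_nat (S M ^ S M) * Z.pos (Pos.of_nat (fact n) * 1))%Z.
    rewrite Pos.mul_1_r, Zpos_of_nat by apply fact_neq_0.
    assert (H := pow_le_fact M n). rewrite <- Nat2Z.inj_mul. lia.
Qed.

Definition CRcos_term x (k : nat) : CRcarrier R :=
  CRpow (CRopp R 1) k * CRexp_term x (2 * k).

Definition CRsin_term x (k : nat) : CRcarrier R :=
  CRpow (CRopp R 1) k * CRexp_term x (2 * k + 1).

Lemma CRabs_sign k : CRabs R (CRpow (CRopp R 1) k) == 1.
Proof.
  rewrite CRpow_abs, CRabs_opp, CRabs_right. { apply CRpow_one. }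
  apply CRlt_asym, CRzero_lt_one.
Qed.

Lemma CRtrig_series_cv x (f : nat -> nat) : (forall k, (k <= f k)%nat) ->
  { l : CRcarrier R & series_cv (fun k => CRpow (CRopp R 1) k * CRexp_term x (f k)) l }.
Proof.
  intro Hf. destruct (CRexp_term_bound x) as [K [HK Hb]].
  destruct (series_cv_maj (fun k => CRpow (CRopp R 1) k * CRexp_term x (f k))
    (fun k => CRpow (CR_of_Q R (1#2)) k * K) (CR_of_Q R 2 * K)) as [l [Hl _]].
  - intro k. rewrite CRabs_mult, CRabs_sign, CRmult_1_l.
    apply (CRle_trans _ _ _ (Hb (f k))).
    apply CRmult_le_compat_r. { exact HK. } apply CRhalf_pow_le, Hf.
  - apply series_cv_scale, GeoHalfTwo.
  - now exists l.
Qed.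

Lemma CRcos_exists x : { c : CRcarrier R & series_cv (CRcos_term x) c }.
Proof. apply CRtrig_series_cv. intro k. lia. Qed.

Lemma CRsin_exists x : { s : CRcarrier R & series_cv (CRsin_term x) s }.
Proof. apply CRtrig_series_cv. intro k. lia. Qed.

Definition CRcos x : CRcarrier R := projT1 (CRcos_exists x).

Definition CRsin x : CRcarrier R := projT1 (CRsin_exists x).

Lemma CR_cv_square (u : nat -> CRcarrier R) (l : CRcarrier R) :
  CR_cv R u l -> CR_cv R (fun n => u n * u n) (l * l).
Proof.
  intro H.
  apply (CR_cv_eq _ (fun n => (u n - l) * (2 * l)
    + ((u n - l) * (u n - l) + l * l))).
  { intro n. rewrite CR_double. ring. }
  apply (CR_cv_proper _ (0 * (2 * l) + (0 + l * l))); [|ring].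
  assert (H0 : CR_cv R (fun n => u n - l) 0).
  { apply (CR_cv_proper _ (l - l)); [|ring].
    apply CR_cv_minus. { exact H. } apply CR_cv_const. }
  apply CR_cv_plus; [|apply CR_cv_plus]; [now apply CR_cv_scale| |apply CR_cv_const].
  intro p. destruct (H0 p) as [n Hn]. exists n. intros i Hi. specialize (Hn i Hi).
  set (w := u i - l) in *.
  assert (E : forall z : CRcarrier R, z - 0 == z) by (intro; ring).
  rewrite E in *. rewrite CRabs_mult.
  apply (CRle_trans _ (1 * CR_of_Q R (1 # p))); [|rewrite CRmult_1_l; apply CRle_refl].
  apply (CRle_trans _ (1 * CRabs R w)).
  - apply CRmult_le_compat_r. { apply CRabs_pos. }
    apply (CRle_trans _ _ _ Hn), CR_of_Q_le. unfold Qle; simpl; lia.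
  - apply CRmult_le_compat_l; [|exact Hn]. apply CRlt_asym, CRzero_lt_one.
Qed.

Definition CRconv (f g : nat -> CRcarrier R) (m : nat) : CRcarrier R :=
  CRsum (fun k => f k * g (m - k)%nat) m.

Lemma CRsum_conv (f g : nat -> CRcarrier R) N :
  CRsum (CRconv f g) N == CRsum (fun p => f p * CRsum g (N - p)) N.
Proof.
  induction N as [|N IH]. { reflexivity. }
  change (CRsum (CRconv f g) (S N))
    with (CRsum (CRconv f g) N
      + (CRsum (fun k => f k * g (S N - k)%nat) N + f (S N) * g (S N - S N)%nat)).
  change (CRsum (fun p => f p * CRsum g (S N - p)) (S N))
    with (CRsum (fun p => f p * CRsum g (S N - p)) N + f (S N) * CRsum g (S N - S N)).
  rewrite IH, (CRsum_eq (fun p => f p * CRsum g (S N - p))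
    (fun p => f p * CRsum g (N - p) + f p * g (S N - p)%nat)).
  - rewrite sum_plus, Nat.sub_diag. simpl. ring.
  - intros i Hi. rewrite Nat.sub_succ_l by exact Hi. simpl. ring.
Qed.

Lemma CRsum_geo_le K n : 0 <= K ->
  CRsum (fun k => CRpow (CR_of_Q R (1#2)) k * K) n <= 2 * K.
Proof.
  intro HK. rewrite sum_scale. apply CRmult_le_compat_r. { exact HK. }
  apply CRlt_asym, GeoHalfBelowTwo.
Qed.

Lemma CRconv_remainder (f g : nat -> CRcarrier R) K N : 0 <= K ->
  (forall k, CRabs R (f k) <= CRpow (CR_of_Q R (1#2)) (2 * k) * K) ->
  (forall k, CRabs R (g k) <= CRpow (CR_of_Q R (1#2)) (2 * k) * K) ->
  CRabs R (CRsum f N * CRsum g N - CRsum (CRconv f g) N)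
    <= CRpow (CR_of_Q R (1#2)) N * (2 * (K * K)).
Proof.
  intros HK Hf Hg. set (h := CRpow (CR_of_Q R (1#2))) in *.
  assert (Hh : forall n, 0 <= h n) by apply CRhalf_pow_ge_0.
  rewrite CRsum_conv, <- sum_scale. unfold CRminus at 1.
  rewrite <- sum_opp, <- sum_plus.
  apply (CRle_trans _ _ _ (multiTriangleIneg _ _)).
  apply (CRle_trans _ (CRsum (fun p => h p * (h N * (K * K))) N)).
  2:{ apply (CRle_trans _ (2 * (h N * (K * K)))).
      - apply CRsum_geo_le. apply CRmult_le_0_compat. { apply Hh. }
        now apply CRmult_le_0_compat.
      - setoid_replace (2 * (h N * (K * K))) with (h N * (2 * (K * K))) by ring.
        apply CRle_refl. }
  apply sum_Rle. intros p Hp.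
  setoid_replace (f p * CRsum g N + - (f p * CRsum g (N - p)))
    with (f p * (CRsum g N - CRsum g (N - p))) by ring.
  rewrite CRabs_mult.
  assert (Hgp : CRabs R (CRsum g N - CRsum g (N - p)) <= h (N - p)%nat * K).
  { assert (Hg' : forall k, CRabs R (g k) <= h k * K).
    { intro k. apply (CRle_trans _ _ _ (Hg k)).
      apply CRmult_le_compat_r. { exact HK. } apply CRhalf_pow_le. lia. }
    apply (CRle_trans _ _ _ (Abs_sum_maj _ _ Hg' _ _)).
    rewrite Nat.max_l, Nat.min_r by lia. rewrite !sum_scale. unfold h.
    rewrite !GeoFiniteSum. fold h.
    apply CRle_of_minus.
    setoid_replace (h (N - p)%nat * K - ((CR_of_Q R 2 - h N) * K
      - (CR_of_Q R 2 - h (N - p)%nat) * K)) with (h N * K) by ring.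
    apply CRmult_le_0_compat; [apply Hh|exact HK]. }
  apply (CRle_trans _ ((h (2 * p)%nat * K) * (h (N - p)%nat * K))).
  - apply (CRle_trans _ ((h (2 * p)%nat * K) * CRabs R (CRsum g N - CRsum g (N - p)))).
    + apply CRmult_le_compat_r. { apply CRabs_pos. } apply Hf.
    + apply CRmult_le_compat_l; [|exact Hgp].
      apply CRmult_le_0_compat; [apply Hh|exact HK].
  - setoid_replace (h (2 * p)%nat * K * (h (N - p)%nat * K))
      with (h (2 * p)%nat * h (N - p)%nat * (K * K)) by ring.
    rewrite <- (CRmult_assoc (h p)). apply CRmult_le_compat_r.
    { now apply CRmult_le_0_compat. }
    unfold h. rewrite !CRpow_plus_distr. apply CRhalf_pow_le. lia.
Qed.

Lemma CRexp_conv_even_odd x m :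
  CRconv (fun k => CRexp_term x (2 * k)) (fun k => CRexp_term x (2 * k)) (S m)
  == CRconv (fun k => CRexp_term x (2 * k + 1)) (fun k => CRexp_term x (2 * k + 1)) m.
Proof.
  unfold CRconv. set (a := CRexp_term x).
  assert (Ha : forall n, INR (S n) * a (S n) == x * a n) by apply CRexp_term_S.
  assert (HD : forall n p, @INR R (n + p) == INR n + INR p).
  { intros n p. unfold INR. rewrite <- CR_of_Q_plus. apply CR_of_Q_morph.
    unfold Qeq; simpl. lia. }
  assert (H0 : @INR R 0 == 0) by reflexivity.
  apply (CRmult_eq_reg_l (INR (2 * S m))).
  { right. apply CR_of_Q_lt. unfold Qlt; simpl. lia. }
  rewrite !(CRmult_comm (INR (2 * S m))), <- !sum_scale.
  rewrite (CRsum_eq _ (fun k => (INR (2 * k) * a (2 * k)%nat) * a (2 * (S m - k))%nat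
    + a (2 * k)%nat * (INR (2 * (S m - k)) * a (2 * (S m - k))%nat))).
  2:{ intros k Hk. replace (2 * S m)%nat with (2 * k + 2 * (S m - k))%nat by lia.
      rewrite HD. ring. }
  rewrite sum_plus, decomp_sum by apply Nat.lt_0_succ.
  rewrite (CRsum_eq (fun i => INR (2 * S i) * a (2 * S i)%nat * a (2 * (S m - S i))%nat)
    (fun k => a (2 * k + 1)%nat * (x * a (2 * (m - k))%nat))).
  2:{ intros k Hk. replace (2 * S k)%nat with (S (2 * k + 1)) by lia.
      rewrite Ha, Nat.sub_succ. ring. }
  change (CRsum (fun k => a (2 * k)%nat * (INR (2 * (S m - k)) * a (2 * (S m - k))%nat)) (S m))
    with (CRsum (fun k => a (2 * k)%nat * (INR (2 * (S m - k)) * a (2 * (S m - k))%nat)) m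
      + a (2 * S m)%nat * (INR (2 * (S m - S m)) * a (2 * (S m - S m))%nat)).
  rewrite (CRsum_eq (fun k => a (2 * k)%nat * (INR (2 * (S m - k)) * a (2 * (S m - k))%nat))
    (fun k => x * a (2 * k)%nat * a (2 * (m - k) + 1)%nat)).
  2:{ intros k Hk. replace (2 * (S m - k))%nat with (S (2 * (m - k) + 1)) by lia.
      rewrite Ha. ring. }
  rewrite Nat.sub_diag, !Nat.mul_0_r, H0.
  rewrite (CRsum_eq (fun k => a (2 * k + 1)%nat * a (2 * (m - k) + 1)%nat * INR (2 * S m))
    (fun k => a (2 * k + 1)%nat * (x * a (2 * (m - k))%nat)
      + x * a (2 * k)%nat * a (2 * (m - k) + 1)%nat)).
  2:{ intros k Hk.
      replace (2 * S m)%nat with (S (2 * k) + S (2 * (m - k)))%nat by lia.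
      rewrite !Nat.add_1_r, HD.
      setoid_replace (a (S (2 * k)) * a (S (2 * (m - k)))
          * (INR (S (2 * k)) + INR (S (2 * (m - k)))))
        with (a (S (2 * (m - k))) * (INR (S (2 * k)) * a (S (2 * k)))
          + a (S (2 * k)) * (INR (S (2 * (m - k))) * a (S (2 * (m - k))))) by ring.
      rewrite !Ha. ring. }
  rewrite sum_plus. simpl Nat.pred. ring.
Qed.

Lemma CRconv_sign (f : nat -> CRcarrier R) m :
  CRconv (fun k => CRpow (CRopp R 1) k * f k) (fun k => CRpow (CRopp R 1) k * f k) m
  == CRpow (CRopp R 1) m * CRconv f f m.
Proof.
  unfold CRconv. rewrite CRmult_comm, <- sum_scale.
  apply CRsum_eq. intros k Hk.
  assert (E : CRpow (CRopp R 1) m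
      == CRpow (CRopp R 1) k * CRpow (CRopp R 1) (m - k)%nat).
  { rewrite CRpow_plus_distr. apply CRpow_morph; [reflexivity|lia]. }
  rewrite E. ring.
Qed.

Lemma CRcos_sin_partial x N :
  CRsum (CRconv (CRcos_term x) (CRcos_term x)) N
    + CRsum (CRconv (CRsin_term x) (CRsin_term x)) N
  == 1 + CRpow (CRopp R 1) N * CRconv (fun k => CRexp_term x (2 * k + 1))
      (fun k => CRexp_term x (2 * k + 1)) N.
Proof.
  set (f0 := fun k => CRexp_term x (2 * k)). set (f1 := fun k => CRexp_term x (2 * k + 1)).
  assert (E0 : forall m, CRconv (CRcos_term x) (CRcos_term x) m
      == CRpow (CRopp R 1) m * CRconv f0 f0 m) by apply (CRconv_sign f0).
  assert (E1 : forall m, CRconv (CRsin_term x) (CRsin_term x) m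
      == CRpow (CRopp R 1) m * CRconv f1 f1 m) by apply (CRconv_sign f1).
  rewrite (CRsum_eq _ _ _ (fun m _ => E0 m)), (CRsum_eq _ _ _ (fun m _ => E1 m)).
  induction N as [|N IH].
  - simpl. unfold CRconv at 1, f0. simpl. rewrite CRexp_term_0. ring.
  - simpl CRsum. simpl CRpow.
    assert (E : CRconv f0 f0 (S N) == CRconv f1 f1 N) by apply CRexp_conv_even_odd.
    rewrite E.
    match goal with |- ?a + ?b + (?c + ?d) == _ =>
      setoid_replace (a + b + (c + d)) with ((a + c) + (b + d)) by ring end.
    rewrite IH. ring.
Qed.

Lemma CRcos_sin_sqr x : CRcos x * CRcos x + CRsin x * CRsin x == 1.
Proof.
  destruct (CRexp_term_bound x) as [K [HK Hb]].
  set (h := CRpow (CR_of_Q R (1#2))) in *.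
  assert (Hh : forall n, 0 <= h n) by apply CRhalf_pow_ge_0.
  set (C := CRsum (CRcos_term x)). set (S' := CRsum (CRsin_term x)).
  assert (Hcv : CR_cv R (fun n => C n * C n + S' n * S' n)
      (CRcos x * CRcos x + CRsin x * CRsin x)).
  { apply CR_cv_plus; apply CR_cv_square.
    - exact (projT2 (CRcos_exists x)).
    - exact (projT2 (CRsin_exists x)). }
  assert (Hbound : forall n, CRabs R (C n * C n + S' n * S' n - 1) <= h n * (6 * (K * K))).
  { intro n.
    set (Cc := CRsum (CRconv (CRcos_term x) (CRcos_term x)) n).
    set (Ss := CRsum (CRconv (CRsin_term x) (CRsin_term x)) n).
    set (B := CRconv (fun k => CRexp_term x (2 * k + 1)) (fun k => CRexp_term x (2 * k + 1)) n).
    assert (HC : CRabs R (C n * C n - Cc) <= h n * (2 * (K * K))).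
    { apply CRconv_remainder; [exact HK| |]; intro k; unfold CRcos_term;
        rewrite CRabs_mult, CRabs_sign, CRmult_1_l; apply Hb. }
    assert (HS : CRabs R (S' n * S' n - Ss) <= h n * (2 * (K * K))).
    { assert (forall k, CRabs R (CRsin_term x k) <= h (2 * k)%nat * K).
      { intro k. unfold CRsin_term. rewrite CRabs_mult, CRabs_sign, CRmult_1_l.
        apply (CRle_trans _ _ _ (Hb _)), CRmult_le_compat_r. { exact HK. }
        apply CRhalf_pow_le. lia. }
      now apply CRconv_remainder. }
    assert (HB : CRabs R B <= h n * (2 * (K * K))).
    { unfold B, CRconv. apply (CRle_trans _ _ _ (multiTriangleIneg _ _)).
      apply (CRle_trans _ (CRsum (fun k => h k * (h n * (K * K))) n)).
      - apply sum_Rle. intros k Hk. rewrite CRabs_mult.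
        apply (CRle_trans _ ((h (2 * k + 1)%nat * K) * (h (2 * (n - k) + 1)%nat * K))).
        + apply (CRle_trans _ ((h (2 * k + 1)%nat * K)
            * CRabs R (CRexp_term x (2 * (n - k) + 1)))).
          * apply CRmult_le_compat_r. { apply CRabs_pos. } apply Hb.
          * apply CRmult_le_compat_l; [|apply Hb].
            apply CRmult_le_0_compat; [apply Hh|exact HK].
        + setoid_replace (h (2 * k + 1)%nat * K * (h (2 * (n - k) + 1)%nat * K))
            with (h (2 * k + 1)%nat * h (2 * (n - k) + 1)%nat * (K * K)) by ring.
          rewrite <- (CRmult_assoc (h k)). apply CRmult_le_compat_r.
          { now apply CRmult_le_0_compat. }
          unfold h. rewrite !CRpow_plus_distr. apply CRhalf_pow_le. lia.
      - apply (CRle_trans _ (2 * (h n * (K * K)))).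
        + apply CRsum_geo_le. apply CRmult_le_0_compat. { apply Hh. }
          now apply CRmult_le_0_compat.
        + setoid_replace (2 * (h n * (K * K))) with (h n * (2 * (K * K))) by ring.
          apply CRle_refl. }
    assert (HE : Cc + Ss - 1 == CRpow (CRopp R 1) n * B).
    { unfold Cc, Ss. rewrite CRcos_sin_partial. fold B. ring. }
    setoid_replace (C n * C n + S' n * S' n - 1)
      with ((C n * C n - Cc) + (S' n * S' n - Ss) + (Cc + Ss - 1)) by ring.
    rewrite HE.
    apply (CRle_trans _ (h n * (2 * (K * K)) + h n * (2 * (K * K)) + h n * (2 * (K * K)))).
    - apply (CRle_trans _ _ _ (CRabs_triang _ _)), CRplus_le_compat.
      + apply (CRle_trans _ _ _ (CRabs_triang _ _)), CRplus_le_compat; assumption.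
      + rewrite CRabs_mult, CRabs_sign, CRmult_1_l. exact HB.
    - assert (E6 : CR_of_Q R 6 == 2 + 2 + 2).
      { rewrite <- !CR_of_Q_plus. now apply CR_of_Q_morph. }
      rewrite E6.
      setoid_replace (h n * ((2 + 2 + 2) * (K * K)))
        with (h n * (2 * (K * K)) + h n * (2 * (K * K)) + h n * (2 * (K * K))) by ring.
      apply CRle_refl. }
  set (l := CRcos x * CRcos x + CRsin x * CRsin x) in *.
  assert (Hl : CRabs R (l - 1) <= 0).
  { apply (CRle_trans _ (0 * (6 * (K * K)))); [|rewrite CRmult_0_l; apply CRle_refl].
    refine (CR_cv_le _ _ _ _ Hbound _ _).
    - apply CR_cv_abs_cont, CR_cv_minus. { exact Hcv. } apply CR_cv_const.
    - apply CR_cv_scale, GeoCvZero. }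
  destruct (CRabs_def2 _ _ Hl) as [H1 H2].
  split; apply CRle_of_minus.
  - setoid_replace (l - 1) with (l - 1 - 0 + 0) by ring.
    rewrite CRplus_0_r. apply CRle_minus. rewrite <- CRopp_0. exact H2.
  - setoid_replace (1 - l) with (0 - (l - 1)) by ring. now apply CRle_minus.
Qed.

Lemma CRmult_self_ge_0 x : 0 <= x * x.
Proof.
  intro H.
  assert (Hx : 0 <= x).
  { intro Hneg. apply (CRlt_asym _ _ H).
    setoid_replace (x * x) with (- x * - x) by ring.
    assert (0 < - x).
    { rewrite <- CRopp_0. now apply CRopp_gt_lt_contravar. }
    now apply CRmult_lt_0_compat. }
  exact (CRmult_le_0_compat _ _ Hx Hx H).
Qed.

End Facts.

Section Metric.

Context {R : ConstructiveReals}.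

Definition is_supremum {I : Type} (f : I -> CRcarrier R) (s : CRcarrier R) : Type :=
  (forall i : I, f i <= s) *
  (forall eps : CRcarrier R, 0 < eps -> { i : I & s - eps < f i }).

Definition unit_interval : Set := { t : CRcarrier R | 0 <= t <= 1 }.

Definition coordinate (t : unit_interval) : CRcarrier R := proj1_sig t.

(* The values of node beyond psize are irrelevant. The end conditions exclude
   psize = 0. *)
Record partition : Set := {
  psize : nat;
  node : nat -> unit_interval;
  node_first : coordinate (node 0%nat) == 0;
  node_last : coordinate (node psize) == 1;
  node_le : forall i : nat, (i < psize)%nat ->
    coordinate (node i) <= coordinate (node (S i))
}.

Context {X : Type} (rho : X -> X -> CRcarrier R).

(* Pointwise continuity on [0,1]. It makes alpha compatible with equality of reals,
   and uniform continuity is a special case. *)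
Definition continuous (alpha : unit_interval -> X) : Type :=
  forall (t : unit_interval) (eps : CRcarrier R), 0 < eps ->
    { delta : CRcarrier R & prod (0 < delta)
        (forall u : unit_interval,
           CRabs R (coordinate t - coordinate u) < delta ->
           rho (alpha t) (alpha u) < eps) }.

(* CRsum f m is the sum of f 0, ..., f m. *)
Definition length_on (P : partition) (alpha : unit_interval -> X) : CRcarrier R :=
  CRsum (fun i => rho (alpha (node P i)) (alpha (node P (S i)))) (pred (psize P)).

Definition is_length (alpha : unit_interval -> X) (l : CRcarrier R) : Type :=
  is_supremum (fun P => length_on P alpha) l.

Definition has_length (alpha : unit_interval -> X) : Type :=
  { l : CRcarrier R & is_length alpha l }.

End Metric.

Arguments unit_interval R : clear implicits.
Arguments partition R : clear implicits.

Section Plane.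

Context {R : ConstructiveReals}.

Add Ring CRring : (CRring_theory R)
  (setoid (CRsetoid_theory R) (CRisRingExt R)).

Definition plane : Set := (CRcarrier R * CRcarrier R)%type.

Definition inner (v w : plane) : CRcarrier R := fst v * fst w + snd v * snd w.

Lemma inner_self_ge_0 (v : plane) : 0 <= inner v v.
Proof.
  unfold inner. rewrite <- (CRplus_0_l 0).
  apply CRplus_le_compat; apply CRmult_self_ge_0.
Qed.

Definition norm (v : plane) : CRcarrier R := CRsqrt (inner v v) (inner_self_ge_0 v).

Definition dist (v w : plane) : CRcarrier R := norm (fst v - fst w, snd v - snd w).

Lemma norm_sqr (v : plane) : norm v * norm v == inner v v.
Proof. apply (proj2_sig (CRsqrt_exists _ (inner_self_ge_0 v))). Qed.

(* The constructive inequality of w and 0. *)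
Definition nonzero (w : plane) : Set := 0 < norm w.

Lemma inner_self_pos (w : plane) : nonzero w -> 0 < inner w w.
Proof. intro H. rewrite <- norm_sqr. now apply CRmult_lt_0_compat. Qed.

Definition projection (w : plane) (Hw : nonzero w) (v : plane) : plane :=
  let c := inner v w * CRinv R (inner w w) (inr (inner_self_pos w Hw)) in
  (c * fst w, c * snd w).

Definition direction (theta : CRcarrier R) : plane := (CRcos theta, CRsin theta).

Lemma direction_nonzero (theta : CRcarrier R) : nonzero (direction theta).
Proof.
  assert (H0 : 0 <= norm (direction theta)).
  { apply (proj2_sig (CRsqrt_exists _ (inner_self_ge_0 (direction theta)))). }
  apply (CRmult_pos_pos _ _) with (3 := H0); [|exact H0].
  rewrite norm_sqr. unfold inner, direction; simpl.
  rewrite CRcos_sin_sqr. apply CRzero_lt_one.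
Qed.

Definition is_path (alpha : unit_interval R -> plane) : Type := continuous dist alpha.

Definition rectifiable (alpha : unit_interval R -> plane) : Type :=
  has_length dist alpha.

Definition is_variation (w : plane) (Hw : nonzero w)
    (alpha : unit_interval R -> plane) (v : CRcarrier R) : Type :=
  is_length dist (fun t => projection w Hw (alpha t)) v.

Definition finite_variation_in_every_direction (alpha : unit_interval R -> plane) : Type :=
  forall theta : CRcarrier R,
    { v : CRcarrier R &
      is_variation (direction theta) (direction_nonzero theta) alpha v }.

End Plane.

Arguments plane R : clear implicits.

(* Main.v *)
Require Import Defs.
From Stdlib Require Import ConstructiveReals CRelationClasses.
From Stdlib Require Import ZArith Arith Lia Factorial Qring Qminmax Qreduction
  Setoid Morphisms Ring.

#[local] Open Scope ConstructiveReals.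

(** Both directions compare the length of a path with finite sums of its
    variations along several vectors, by approximating the Euclidean norm of the
    plane by the support function of a convex polygon.

    Constructively, the existence of a length is a statement about the rate of
    convergence. By the triangle inequality the lengths [u m] along the dyadic
    partitions of level [m] increase, and by continuity at the nodes every
    partition is dominated, up to [eps], by a dyadic one. So the length exists if
    and only if for each [eps] some [u m] cannot be exceeded by more than [eps]
    at any level ([has_length_iff_dyadic]). This holds for every pseudometric, in
    particular for the distance of the projections onto a line, and it turns the
    theorem into a statement about nondecreasing sequences that depend linearly
    on the pseudometric. A common refinement of two partitions with real nodes
    is never formed.

    A centrally symmetric polygon with the edges [E] has the support function
    [v |-> 1/2 sum_E |<v, E>|] (one edge of each opposite pair being counted),
    which is a sum of distances along vectors. Let [n = m + 1]. Inscribe in the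
    unit circle a polygon with about [4 n] sides. Its support function [N]
    satisfies [N v <= |v|] and [n^2 (|v| - N v) <= 2 |v|], and it can be placed
    such that the edge in the direction of a given unit vector [e] contributes
    [c |<v, e>|] with [n c >= 1] ([slanted_dist_bounds], [vertex_x_last]).

    Rectifiability implies finite variation ([stabilizes_along_unit]). Write
    [N = c |<., e>| + G]. The variation for [G] increases under refinement. Hence,
    if refinement increases the length of the path by at most [d], it increases
    the variation along [e] by at most [(d + 2 l / n^2) / c <= n d + 2 l / n],
    where [l] is the length. Choose [n] first and [d] afterwards.

    Finite variation implies rectifiability ([stabilizes_dist]). It suffices that
    the variation exists along the edges of the polygon, because then the sum for
    [N] stabilizes, and the length is a uniform limit of such sums. The given
    directions are the unit vectors of angle [theta], with sine and cosine
    defined by power series. These are Lipschitz, and the cosine is negative and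
    the sine positive at [2], so an approximate intermediate value argument finds
    a [theta] whose direction is almost parallel to a given vector
    ([direction_quadrant]). The variation depends continuously on the vector as
    soon as the lengths are bounded, and two directions suffice to bound them. *)

(** * Arithmetic and order *)

(** This lets [ring] compute with rational constants. *)
Lemma CR_of_Q_ring_morph (R : ConstructiveReals) :
  ring_morph (CR_of_Q R 0) (CR_of_Q R 1) (CRplus R) (CRmult R) (CRminus R) (CRopp R) (CReq R)
    0%Q 1%Q Qplus Qmult Qminus Qopp Qeq_bool (CR_of_Q R).
Proof.
  constructor; try reflexivity.
  - apply CR_of_Q_plus.
  - intros x y. unfold Qminus, CRminus. rewrite CR_of_Q_plus, CR_of_Q_opp. reflexivity.
  - apply CR_of_Q_mult.
  - apply CR_of_Q_opp.
  - intros x y H. now apply CR_of_Q_morph, Qeq_bool_iff.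
Qed.

Ltac CR_constant t :=
  match t with
  | CR_of_Q _ ?q => match isQcst q with true => q | _ => constr:(NotConstant) end
  | _ => constr:(NotConstant)
  end.

Lemma CRplus_nonneg {R : ConstructiveReals} (x y : CRcarrier R) : 0 <= x -> 0 <= y -> 0 <= x + y.
Proof.
  intros Hx Hy. rewrite <- (CRplus_0_l 0). now apply CRplus_le_compat.
Qed.

Ltac nonneg :=
  match goal with
  | |- 0 <= _ => assumption
  | |- 0 <= CR_of_Q _ _ => apply CR_of_Q_le; discriminate
  | |- 0 <= ?x * ?x => apply CRmult_self_ge_0
  | |- 0 <= _ + _ => apply CRplus_nonneg; nonneg
  | |- 0 <= _ * _ => apply CRmult_le_0_compat; nonneg
  | |- 0 <= CRabs _ _ => apply CRabs_pos
  | |- 0 <= _ - _ => apply CRle_minus; first [assumption | apply CRlt_asym; assumption]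
  | |- 0 <= _ => apply CRlt_asym; assumption
  end.

(** Proves [x <= y] from a term [e] that equals [y - x] by [ring] and that is visibly
    a sum of products of nonnegative factors: the role of [e] is that of the
    coefficients of a linear combination of the hypotheses. *)
Ltac certify e :=
  apply CRle_of_minus;
  match goal with |- 0 <= ?d => setoid_replace d with e by ring end; nonneg.

Section Proof.

Context {R : ConstructiveReals}.
Implicit Types (x y a b p q K L M eps delta nu : CRcarrier R) (e v w : plane R).

Add Ring CRring : (CRring_theory R)
  (setoid (CRsetoid_theory R) (CRisRingExt R), morphism (CR_of_Q_ring_morph R),
   constants [CR_constant]).

#[local] Notation half := (CR_of_Q R (1#2)).

(** As [x <= y] is a negation, it may be proved by undecidable case distinctions. *)
Lemma CRle_stable (P : Prop) x y : ~ ~ P -> (P -> x <= y) -> x <= y.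
Proof. intros HP H Hlt. apply HP. intro p. exact (H p Hlt). Qed.

Lemma CRle_not_not_total a b : ~ ~ (a <= b \/ b <= a).
Proof.
  intro H. apply H. left. intro Hlt. apply H. right. now apply CRlt_asym.
Qed.

Lemma CRle_cases a b x y : (a <= b -> x <= y) -> (b <= a -> x <= y) -> x <= y.
Proof.
  intros H1 H2. apply (CRle_stable _ _ _ (CRle_not_not_total a b)). now intros [H|H]; auto.
Qed.

Lemma CReq_cases a b x y : (a <= b -> x == y) -> (b <= a -> x == y) -> x == y.
Proof.
  intros H1 H2. split; apply (CRle_cases a b); intro H; first [apply H1, H | apply H2, H].
Qed.

Lemma CRle_of_eq x y : x == y -> x <= y.
Proof. intros [_ H]. exact H. Qed.

Lemma CRle_forall_eps x y : (forall eps : CRcarrier R, 0 < eps -> x <= y + eps) -> x <= y.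
Proof.
  intros H Hlt. set (h := half).
  assert (Hh : 0 < (x - y) * h).
  { apply CRmult_lt_0_compat. { now apply CRlt_minus. } apply CR_of_Q_lt. reflexivity. }
  specialize (H _ Hh). revert Hlt. unfold h in H.
  certify (2 * (y + (x - y) * half - x)).
Qed.

Lemma CRabs_square x : CRabs R x * CRabs R x == x * x.
Proof.
  rewrite <- CRabs_mult. apply CRabs_right, CRmult_self_ge_0.
Qed.

Lemma CRle_of_squares x y : 0 <= y -> x * x <= y * y -> x <= y.
Proof.
  intros Hy H Hlt.
  assert (H1 : 0 < x - y) by now apply CRlt_minus.
  assert (H2 : 0 < x + y).
  { apply (CRlt_le_trans _ (x - y) _ H1). certify (2 * y). }
  apply H. apply (CRplus_lt_reg_r (- (y * y))). rewrite CRplus_opp_r.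
  setoid_replace (x * x + - (y * y)) with ((x - y) * (x + y)) by ring.
  now apply CRmult_lt_0_compat.
Qed.

Lemma INR_S (k : nat) : @INR R (S k) == @INR R k + 1.
Proof.
  unfold INR. rewrite <- CR_of_Q_plus. apply CR_of_Q_morph.
  unfold Qeq, Qplus. cbn [Qnum Qden]. lia.
Qed.

Lemma INR_nonneg (k : nat) : 0 <= @INR R k.
Proof. apply CR_of_Q_le. unfold Qle. cbn [Qnum Qden]. lia. Qed.

Lemma INR_le (j k : nat) : (j <= k)%nat -> @INR R j <= @INR R k.
Proof. intro. apply CR_of_Q_le. unfold Qle. cbn [Qnum Qden]. lia. Qed.

Lemma INR_S_pos n : 0 < @INR R (S n).
Proof. apply CR_of_Q_lt. unfold Qlt. cbn [Qnum Qden]. lia. Qed.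

Lemma half_pos (eps : CRcarrier R) : 0 < eps -> 0 < half * eps.
Proof. intro H. apply CRmult_lt_0_compat; [apply CR_of_Q_lt; reflexivity | exact H]. Qed.

(** Plays the role of [eps / L] where [L] may vanish. *)
Lemma small_factor L eps : 0 <= L -> 0 < eps ->
  { d : CRcarrier R & prod (0 < d) (d * L <= eps) }.
Proof.
  intros HL Heps.
  assert (H1 : 0 < L + 1).
  { apply (CRle_lt_trans _ L _ HL). rewrite <- (CRplus_0_r L) at 1.
    apply CRplus_lt_compat_l, CRzero_lt_one. }
  set (i := CRinv R (L + 1) (inr H1)).
  assert (Hi : 0 < i) by now apply CRinv_0_lt_compat.
  assert (Hie : 0 < i * eps) by now apply CRmult_lt_0_compat.
  exists (i * eps). split. { exact Hie. }
  assert (E : i * (L + 1) == 1) by apply CRinv_l.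
  apply (CRle_trans _ (i * (L + 1) * eps)).
  - certify (i * eps).
  - rewrite E. apply CRle_of_eq. ring.
Qed.

Lemma archimedean_factor K eps : 0 <= K -> 0 < eps -> { m : nat | K <= INR (S m) * eps }.
Proof.
  intros HK Heps. destruct (small_factor K eps HK Heps) as [d [Hd HdK]].
  destruct (CRup_nat (CRinv R d (inr Hd))) as [m Hm].
  exists m.
  assert (Ed : CRinv R d (inr Hd) * d == 1) by apply CRinv_l.
  assert (H : CRinv R d (inr Hd) <= INR (S m)).
  { apply (CRle_trans _ (INR m)). { now apply CRlt_asym. } apply INR_le. lia. }
  set (i := CRinv R d (inr Hd)) in *.
  assert (Hi : 0 <= i) by (apply CRlt_asym, CRinv_0_lt_compat, Hd).
  apply (CRle_trans _ (i * d * K)). { rewrite Ed. apply CRle_of_eq. ring. }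
  assert (He := CRlt_asym _ _ Heps).
  certify (i * (eps - d * K) + (INR (S m) - i) * eps).
Qed.

(** Sums over an initial segment of the integers that may be empty, as the
    stages of an induction along a partition need them. *)
Fixpoint sum_below (f : nat -> CRcarrier R) (n : nat) : CRcarrier R :=
  match n with
  | O => 0
  | S n => sum_below f n + f n
  end.

Lemma CRsum_below f n : CRsum f n == sum_below f (S n).
Proof.
  induction n as [|n IH]; simpl. { ring. }
  rewrite IH. reflexivity.
Qed.

Lemma sum_below_le f g n : (forall k, (k < n)%nat -> f k <= g k) ->
  sum_below f n <= sum_below g n.
Proof.
  intro H. induction n as [|n IH]; simpl. { apply CRle_refl. }
  apply CRplus_le_compat; [apply IH; intros; apply H; lia | apply H; lia].
Qed.

Lemma sum_below_ext f g n : (forall k, (k < n)%nat -> f k == g k) ->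
  sum_below f n == sum_below g n.
Proof. intro H. split; apply sum_below_le; intros k Hk; apply (H k Hk). Qed.

Lemma sum_below_mono f m n : (forall k, 0 <= f k) -> (m <= n)%nat ->
  sum_below f m <= sum_below f n.
Proof.
  intros Hf. induction 1 as [|n _ IH]. { apply CRle_refl. }
  apply (CRle_trans _ _ _ IH). simpl. apply Rplus_le_pos, Hf.
Qed.

Lemma sum_below_pairs f n :
  sum_below f (2 * n) == sum_below (fun k => f (2 * k)%nat + f (S (2 * k))) n.
Proof.
  induction n as [|n IH]. { reflexivity. }
  replace (2 * S n)%nat with (S (S (2 * n))) by lia.
  change (sum_below f (2 * n) + f (2 * n)%nat + f (S (2 * n))
    == sum_below (fun k => f (2 * k)%nat + f (S (2 * k))) n + (f (2 * n)%nat + f (S (2 * n)))).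
  rewrite IH. ring.
Qed.

Lemma sum_below_telescope (f g : nat -> CRcarrier R) j k : (j <= k)%nat ->
  (forall i, (j <= i < k)%nat -> f i == g i - g (S i)) ->
  sum_below f k - sum_below f j == g j - g k.
Proof.
  induction 1 as [|k Hjk IH]; intro E. { ring. }
  simpl. rewrite (E k) by lia.
  transitivity (sum_below f k - sum_below f j + (g k - g (S k))). { ring. }
  rewrite IH. { ring. } intros. apply E. lia.
Qed.

(** * Nondecreasing sequences *)

Definition nondecreasing (u : nat -> CRcarrier R) : Prop := forall n, u n <= u (S n).

(** For a nondecreasing sequence, this is the existence of the supremum. It is
    stated without a limit, so that it can be transferred between sequences by
    inequalities. *)
Definition stabilizes (u : nat -> CRcarrier R) : Set :=
  forall eps : CRcarrier R, 0 < eps -> { m : nat | forall k, u k <= u m + eps }.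

Lemma nondecreasing_le u m n : nondecreasing u -> (m <= n)%nat -> u m <= u n.
Proof. intro H. now apply CR_growing_transit. Qed.

Lemma stabilizes_supremum u : nondecreasing u -> stabilizes u ->
  { s : CRcarrier R & is_supremum u s }.
Proof.
  intros Hu Hs.
  assert (Hc : CR_cauchy R u).
  { intro p. destruct (Hs (CR_of_Q R (1#p))) as [m Hm]. { apply CR_of_Q_lt. reflexivity. }
    exists m. intros i j Hi Hj.
    assert (Hmi := nondecreasing_le u m i Hu Hi).
    assert (Hmj := nondecreasing_le u m j Hu Hj).
    assert (Hki := Hm i). assert (Hkj := Hm j).
    set (e := CR_of_Q R (1#p)) in *.
    apply CRabs_le. split.
    - certify ((u i - u m) + (u m + e - u j)).
    - certify ((u j - u m) + (u m + e - u i)). }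
  destruct (CR_complete R u Hc) as [s Hcv]. exists s. split.
  - now apply growing_ineq.
  - intros eps Heps. destruct (Hs _ (half_pos eps Heps)) as [m Hm]. exists m.
    assert (Hsm : s <= u m + half * eps).
    { apply (CR_cv_bound_up u _ s O); [|exact Hcv]. intros; apply Hm. }
    apply (CRplus_lt_reg_r (half * eps)).
    apply (CRlt_le_trans _ s); [|exact Hsm].
    apply (CRlt_le_trans _ (s - half * eps + half * eps)).
    + apply CRplus_lt_compat_r, CRplus_lt_compat_l, CRopp_gt_lt_contravar.
      setoid_replace eps with (half * eps + half * eps) at 2 by ring.
      rewrite <- (CRplus_0_l (half * eps)) at 1.
      now apply CRplus_lt_compat_r, half_pos.
    + apply CRle_of_eq. ring.
Qed.

Lemma stabilizes_bounded u : stabilizes u -> { K : CRcarrier R | forall k, u k <= K }.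
Proof.
  intro H. destruct (H 1 (CRzero_lt_one R)) as [m Hm]. now exists (u m + 1).
Qed.

Lemma stabilizes_plus (u v : nat -> CRcarrier R) : nondecreasing u -> nondecreasing v ->
  stabilizes u -> stabilizes v -> stabilizes (fun k => u k + v k).
Proof.
  intros Hu Hv Su Sv eps Heps.
  destruct (Su _ (half_pos eps Heps)) as [m Hm]. destruct (Sv _ (half_pos eps Heps)) as [n Hn].
  exists (Nat.max m n). intro k.
  assert (H1 := nondecreasing_le u _ _ Hu (Nat.le_max_l m n)).
  assert (H2 := nondecreasing_le v _ _ Hv (Nat.le_max_r m n)).
  specialize (Hm k). specialize (Hn k).
  certify ((u m + half * eps - u k) + (v n + half * eps - v k)
    + (u (Nat.max m n) - u m) + (v (Nat.max m n) - v n)).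
Qed.

Lemma stabilizes_scale c u : 0 <= c -> stabilizes u -> stabilizes (fun k => c * u k).
Proof.
  intros Hc Su eps Heps. destruct (small_factor c eps Hc Heps) as [d [Hd Hdc]].
  destruct (Su d Hd) as [m Hm]. exists m. intro k. specialize (Hm k).
  certify (c * (u m + d - u k) + (eps - d * c)).
Qed.

Lemma stabilizes_uniform_limit u :
  (forall eps : CRcarrier R, 0 < eps ->
     { v : nat -> CRcarrier R & prod (stabilizes v) (forall k, CRabs R (u k - v k) <= eps) }) ->
  stabilizes u.
Proof.
  intros H eps Heps. set (t := CR_of_Q R (1#3) * eps).
  assert (Ht : 0 < t) by (apply CRmult_lt_0_compat; [apply CR_of_Q_lt; reflexivity | exact Heps]).
  destruct (H t Ht) as [v [Sv Hv]]. destruct (Sv t Ht) as [m Hm].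
  exists m. intro k. specialize (Hm k).
  destruct (CRabs_def2 _ _ (Hv k)) as [H1 _]. destruct (CRabs_def2 _ _ (Hv m)) as [_ H2].
  unfold t in *.
  certify ((CR_of_Q R (1#3) * eps - (u k - v k)) + ((u m - v m) - - (CR_of_Q R (1#3) * eps))
    + (v m + CR_of_Q R (1#3) * eps - v k)).
Qed.

Lemma stabilizes_ext (u v : nat -> CRcarrier R) : (forall k, u k == v k) ->
  stabilizes u -> stabilizes v.
Proof.
  intros E Su eps Heps. destruct (Su eps Heps) as [m Hm]. exists m.
  intro k. rewrite <- !E. apply Hm.
Qed.

Lemma stabilizes_sum_below (u : nat -> nat -> CRcarrier R) n :
  (forall i, (i < n)%nat -> nondecreasing (u i)) ->
  (forall i, (i < n)%nat -> stabilizes (u i)) ->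
  stabilizes (fun k => sum_below (fun i => u i k) n).
Proof.
  intros Hu Hs. induction n as [|n IH].
  - intros eps Heps. exists O. intro k. simpl. nonneg.
  - simpl. apply stabilizes_plus.
    + intro k. apply sum_below_le. intros i Hi. apply Hu. lia.
    + apply Hu. lia.
    + apply IH; intros i Hi; [apply Hu | apply Hs]; lia.
    + apply Hs. lia.
Qed.

(** * Dyadic partitions *)

Lemma clamp_bounds (q : Q) :
  0 <= CR_of_Q R (Qmax 0 (Qmin q 1)) <= 1.
Proof.
  split; apply CR_of_Q_le.
  - apply Q.le_max_l.
  - apply Q.max_lub. { discriminate. } apply Q.le_min_r.
Qed.

(** Rational numbers are clamped, so that this depends on nothing but [q]. *)
Definition rational_point (q : Q) : unit_interval R :=
  exist _ (CR_of_Q R (Qmax 0 (Qmin q 1))) (clamp_bounds q).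

Definition dyadic (m k : nat) : Q := Z.of_nat k # Pos.of_nat (2 ^ m).

(** Reduced fractions make the points of one level literally equal to points of
    the next one, and not only points with equal coordinates. So lengths increase
    with the level for every function on the interval. *)
Definition dyadic_point (m k : nat) : unit_interval R :=
  rational_point (Qred (dyadic m k)).

Lemma pow2_pos m : Z.pos (Pos.of_nat (2 ^ m)) = Z.of_nat (2 ^ m).
Proof. apply Zpos_of_nat. apply Nat.pow_nonzero. discriminate. Qed.

Lemma dyadic_point_double m k : dyadic_point (S m) (2 * k) = dyadic_point m k.
Proof.
  unfold dyadic_point. f_equal. apply Qred_complete. unfold Qeq, dyadic.
  cbn [Qnum Qden]. rewrite !pow2_pos, Nat.pow_succ_r'. lia.
Qed.

Lemma coordinate_dyadic m k : (k <= 2 ^ m)%nat ->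
  coordinate (dyadic_point m k) == CR_of_Q R (dyadic m k).
Proof.
  intro Hk. apply CR_of_Q_morph.
  transitivity (Qred (dyadic m k)); [|apply Qred_correct].
  rewrite Q.min_l. 2:{ rewrite Qred_correct. unfold Qle, dyadic. cbn [Qnum Qden].
    rewrite pow2_pos. lia. }
  apply Q.max_r. rewrite Qred_correct. unfold Qle, dyadic. cbn [Qnum Qden]. lia.
Qed.

Lemma dyadic_le m j k : (j <= k)%nat -> CR_of_Q R (dyadic m j) <= CR_of_Q R (dyadic m k).
Proof. intro H. apply CR_of_Q_le. unfold Qle, dyadic. cbn [Qnum Qden]. nia. Qed.

Lemma dyadic_0 m : CR_of_Q R (dyadic m 0) == 0.
Proof. apply CR_of_Q_morph. reflexivity. Qed.

Lemma dyadic_full m : CR_of_Q R (dyadic m (2 ^ m)) == 1.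
Proof.
  apply CR_of_Q_morph. unfold Qeq, dyadic. cbn [Qnum Qden]. rewrite pow2_pos. lia.
Qed.

Definition dyadic_partition (m : nat) : partition R.
Proof.
  refine {| psize := 2 ^ m; node := dyadic_point m |}.
  - rewrite coordinate_dyadic by lia. apply dyadic_0.
  - rewrite coordinate_dyadic by lia. apply dyadic_full.
  - intros i Hi. rewrite !coordinate_dyadic by lia. apply dyadic_le. lia.
Defined.

(** The rational number [dyadic m 1] is the mesh of the level [m]. *)
Lemma dyadic_S m k : CR_of_Q R (dyadic m (S k)) == CR_of_Q R (dyadic m k) + CR_of_Q R (dyadic m 1).
Proof.
  rewrite <- CR_of_Q_plus. apply CR_of_Q_morph.
  unfold Qeq, dyadic, Qplus. cbn [Qnum Qden]. lia.
Qed.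

Lemma dyadic_mesh_small (delta : CRcarrier R) : 0 < delta ->
  { m : nat & CR_of_Q R (dyadic m 1) < delta }.
Proof.
  intro H. destruct (CR_Q_dense R 0 delta H) as [q [H0 Hq]].
  apply lt_CR_of_Q in H0. exists (Pos.to_nat (Qden q)).
  apply (CRle_lt_trans _ (CR_of_Q R q)); [|exact Hq].
  apply CR_of_Q_le. unfold Qle, Qlt in *. cbn [Qnum Qden dyadic] in *.
  rewrite pow2_pos.
  assert (Hp := Nat.pow_gt_lin_r 2 (Pos.to_nat (Qden q)) (Nat.lt_1_2)).
  assert (Z.of_nat (Pos.to_nat (Qden q)) = Z.pos (Qden q)) by apply positive_nat_Z.
  nia.
Qed.

Lemma dyadic_mesh_mono m n : (m <= n)%nat ->
  CR_of_Q R (dyadic n 1) <= CR_of_Q R (dyadic m 1).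
Proof.
  intro H. apply CR_of_Q_le. unfold Qle. cbn [Qnum Qden dyadic]. rewrite !pow2_pos.
  assert (Hp := Nat.pow_le_mono_r 2 m n ltac:(discriminate) H). lia.
Qed.

Lemma dyadic_mesh_small_all (delta : nat -> CRcarrier R) n : (forall i, 0 < delta i) ->
  { m : nat & forall i, (i <= n)%nat -> CR_of_Q R (dyadic m 1) < delta i }.
Proof.
  intro H. induction n as [|n [m Hm]].
  - destruct (dyadic_mesh_small _ (H O)) as [m Hm]. exists m. intros i Hi.
    replace i with O by lia. exact Hm.
  - destruct (dyadic_mesh_small _ (H (S n))) as [m' Hm'].
    exists (Nat.max m m'). intros i Hi.
    destruct (Nat.eq_dec i (S n)) as [->|Hne].
    + apply (CRle_lt_trans _ (CR_of_Q R (dyadic m' 1))); [|exact Hm'].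
      apply dyadic_mesh_mono. lia.
    + apply (CRle_lt_trans _ (CR_of_Q R (dyadic m 1))); [|apply Hm; lia].
      apply dyadic_mesh_mono. lia.
Qed.

(** Which dyadic interval contains a real number cannot be decided. The double
    negation suffices because the lemma only serves to prove inequalities. *)
Lemma dyadic_floor m k x : (k <= 2 ^ m)%nat ->
  CR_of_Q R (dyadic m k) <= x -> x <= 1 ->
  ~ ~ exists j, (k <= j <= 2 ^ m)%nat
      /\ CR_of_Q R (dyadic m j) <= x <= CR_of_Q R (dyadic m (S j)).
Proof.
  intros Hk. remember (2 ^ m - k)%nat as d eqn:Ed. revert k Hk Ed.
  induction d as [|d IH]; intros k Hk Ed Hx Hx1 HF.
  - apply HF. exists k. split. { lia. } split. { exact Hx. }
    apply (CRle_trans _ _ _ Hx1). rewrite <- (dyadic_full m). apply dyadic_le. lia.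
  - apply (CRle_not_not_total x (CR_of_Q R (dyadic m (S k)))). intros [H|H].
    + apply HF. exists k. split. { lia. } now split.
    + apply (IH (S k)); try assumption; try lia.
      intros (j & Hj & Hjx). apply HF. exists j. split; [lia | exact Hjx].
Qed.

(** * Lengths along dyadic partitions *)

Section Length.

Context {X : Type}.
Implicit Types rho : X -> X -> CRcarrier R.

Definition triangular rho : Prop := forall x y z : X, rho x z <= rho x y + rho y z.

Record pseudometric rho : Prop := {
  pm_refl : forall x : X, rho x x == 0;
  pm_sym : forall x y : X, rho x y == rho y x;
  pm_triangle : triangular rho
}.

Lemma pm_nonneg rho : pseudometric rho -> forall x y : X, 0 <= rho x y.
Proof.
  intros H x y. assert (H1 := pm_triangle rho H x y x).
  rewrite (pm_refl rho H), (pm_sym rho H y x) in H1.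
  certify (half * (rho x y + rho x y - 0)).
Qed.

Lemma triangular_plus rho1 rho2 :
  triangular rho1 -> triangular rho2 -> triangular (fun x y : X => rho1 x y + rho2 x y).
Proof.
  intros H1 H2 x y z. specialize (H1 x y z). specialize (H2 x y z).
  certify ((rho1 x y + rho1 y z - rho1 x z) + (rho2 x y + rho2 y z - rho2 x z)).
Qed.

Lemma triangular_scale c rho : 0 <= c ->
  triangular rho -> triangular (fun x y : X => c * rho x y).
Proof.
  intros Hc H x y z. specialize (H x y z).
  certify (c * (rho x y + rho y z - rho x z)).
Qed.

Lemma triangular_sum (rho : nat -> X -> X -> CRcarrier R) n :
  (forall k, triangular (rho k)) -> triangular (fun x y : X => sum_below (fun k => rho k x y) n).
Proof.
  intro H. induction n as [|n IH].
  - intros x y z. apply CRle_of_eq. simpl. ring.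
  - simpl. exact (triangular_plus _ _ IH (H n)).
Qed.

Lemma psize_neq_0 (P : partition R) : psize P <> O.
Proof.
  intro H. assert (E : CR_of_Q R 1 == 0).
  { rewrite <- (node_last P), H. apply node_first. }
  destruct E as [_ E]. exact (E (CRzero_lt_one R)).
Qed.

Lemma length_on_sum rho (P : partition R) alpha :
  length_on rho P alpha
  == sum_below (fun i => rho (alpha (node P i)) (alpha (node P (S i)))) (psize P).
Proof.
  unfold length_on. rewrite CRsum_below.
  rewrite Nat.succ_pred by apply psize_neq_0. reflexivity.
Qed.

Definition dyadic_length rho (alpha : unit_interval R -> X) (m : nat) : CRcarrier R :=
  length_on rho (dyadic_partition m) alpha.

Lemma dyadic_length_sum rho alpha m :
  dyadic_length rho alpha m
  == sum_below (fun i => rho (alpha (dyadic_point m i)) (alpha (dyadic_point m (S i)))) (2 ^ m).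
Proof. apply (length_on_sum rho (dyadic_partition m)). Qed.

Lemma dyadic_length_nondecreasing rho alpha : triangular rho ->
  nondecreasing (dyadic_length rho alpha).
Proof.
  intros H m. rewrite !dyadic_length_sum, Nat.pow_succ_r', sum_below_pairs.
  apply sum_below_le. intros k _.
  replace (S (S (2 * k))) with (2 * S k)%nat by lia.
  rewrite !dyadic_point_double. apply H.
Qed.

(** Moving each node of [P] down to the dyadic point below it changes the length
    little, if the level [m] suits the continuity at the nodes. Thereafter the
    dyadic partition is a refinement. Only [m] is computed; the positions of the
    nodes among the dyadic points serve to prove an inequality, for which their
    existence up to double negation is enough. *)
Lemma length_on_le_dyadic rho alpha : pseudometric rho -> continuous rho alpha ->
  forall (P : partition R) (eps : CRcarrier R), 0 < eps ->
  { m : nat | length_on rho P alpha <= dyadic_length rho alpha m + eps }.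
Proof.
  intros Hrho Hc P eps Heps.
  assert (Hn : psize P <> O) by apply psize_neq_0.
  set (n := psize P) in *. set (x := node P).
  set (e := CR_of_Q R (1 # Pos.of_nat (2 * n)) * eps).
  assert (He : 0 < e).
  { apply CRmult_lt_0_compat; [apply CR_of_Q_lt; reflexivity | exact Heps]. }
  destruct (dyadic_mesh_small_all (fun i => projT1 (Hc (x i) e He)) n) as [m Hm].
  { intro i. apply (fst (projT2 (Hc (x i) e He))). }
  exists m. set (z := fun k => alpha (dyadic_point m k)).
  set (B := sum_below (fun k => rho (z k) (z (S k)))).
  assert (HB : forall j k, (j <= k)%nat -> rho (z j) (z k) <= B k - B j).
  { intros j k. induction 1 as [|k Hjk IH].
    - rewrite (pm_refl rho Hrho). apply CRle_of_eq. ring.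
    - apply (CRle_trans _ _ _ (pm_triangle rho Hrho _ (z k) _)).
      unfold B. simpl. fold B.
      certify (B k - B j - rho (z j) (z k)). }
  assert (Hclose : forall i k, (i <= n)%nat -> (k <= 2 ^ m)%nat ->
    CR_of_Q R (dyadic m k) <= coordinate (x i) <= CR_of_Q R (dyadic m (S k)) ->
    rho (alpha (x i)) (z k) <= e).
  { intros i k Hi Hk [H1 H2]. apply CRlt_asym.
    apply (snd (projT2 (Hc (x i) e He))).
    apply (CRle_lt_trans _ (CR_of_Q R (dyadic m 1))); [|now apply Hm].
    rewrite coordinate_dyadic by exact Hk.
    rewrite dyadic_S in H2.
    rewrite CRabs_right by nonneg.
    certify (CR_of_Q R (dyadic m k) + CR_of_Q R (dyadic m 1) - coordinate (x i)). }
  set (A := sum_below (fun i => rho (alpha (x i)) (alpha (x (S i))))).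
  (* The part of [P] up to its node [i] is compared with the dyadic partition up to
     the dyadic point [k] below this node. *)
  assert (HA : forall i, (i <= n)%nat -> ~ ~ exists k, (k <= 2 ^ m)%nat
    /\ CR_of_Q R (dyadic m k) <= coordinate (x i) <= CR_of_Q R (dyadic m (S k))
    /\ A i <= B k + INR i * (2 * e)).
  { induction i as [|i IH]; intros Hi HF.
    - apply HF. exists O. split. { lia. } split. { split.
      - rewrite dyadic_0. apply (proj2_sig (x O)).
      - unfold x. rewrite (node_first P), <- (dyadic_0 m). apply dyadic_le. lia. }
      apply CRle_of_eq. unfold A, B, INR. simpl. ring.
    - apply IH. { lia. } clear IH. intros (k & Hk & Hki & HAi).
      assert (Hmono : coordinate (x i) <= coordinate (x (S i))) by (apply node_le; exact Hi).
      apply (dyadic_floor m k (coordinate (x (S i))) Hk).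
      { apply (CRle_trans _ _ _ (proj1 Hki) Hmono). }
      { apply (proj2_sig (x (S i))). }
      intros (j & Hj & Hji). apply HF. exists j. split. { lia. } split. { exact Hji. }
      assert (H1 := Hclose i k ltac:(lia) Hk Hki).
      assert (H2 := Hclose (S i) j Hi ltac:(lia) Hji).
      assert (H3 := HB k j ltac:(lia)).
      assert (H4 := pm_triangle rho Hrho (alpha (x i)) (z k) (alpha (x (S i)))).
      assert (H5 := pm_triangle rho Hrho (z k) (z j) (alpha (x (S i)))).
      rewrite (pm_sym rho Hrho (z j)) in H5.
      assert (E : @INR R (S i) == INR i + 1).
      { unfold INR. rewrite <- CR_of_Q_plus. apply CR_of_Q_morph.
        unfold Qeq, Qplus. cbn [Qnum Qden]. lia. }
      rewrite E.
      change (A (S i)) with (A i + rho (alpha (x i)) (alpha (x (S i)))).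
      set (r1 := rho (alpha (x i)) (alpha (x (S i)))) in *.
      set (r2 := rho (alpha (x i)) (z k)) in *.
      set (r3 := rho (z k) (alpha (x (S i)))) in *.
      set (r4 := rho (z k) (z j)) in *.
      set (r5 := rho (alpha (x (S i))) (z j)) in *.
      certify ((B k + INR i * (2 * e) - A i) + (r2 + r3 - r1) + (r4 + r5 - r3) + (e - r2)
        + (e - r5) + (B j - B k - r4)). }
  apply (CRle_stable _ _ _ (HA n (le_n n))). intros (k & Hk & _ & Hle).
  rewrite length_on_sum, dyadic_length_sum. fold n x A.
  change (A n <= B (2 ^ m)%nat + eps).
  assert (HBk : B k <= B (2 ^ m)%nat).
  { apply sum_below_mono; [|exact Hk]. intro. now apply pm_nonneg. }
  assert (E : INR n * (2 * e) == eps).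
  { unfold e, INR. rewrite <- (CRmult_1_l eps) at 2. rewrite <- !CRmult_assoc.
    apply CRmult_morph; [|reflexivity]. rewrite <- !CR_of_Q_mult. apply CR_of_Q_morph.
    unfold Qeq, Qmult. cbn [Qnum Qden]. rewrite !Pos.mul_1_l, Zpos_of_nat by lia. lia. }
  rewrite E in Hle.
  certify ((B (2 ^ m)%nat - B k) + (B k + eps - A n)).
Qed.

Theorem has_length_iff_dyadic rho alpha : pseudometric rho -> continuous rho alpha ->
  iffT (has_length rho alpha) (stabilizes (dyadic_length rho alpha)).
Proof.
  intros Hrho Hc. split.
  - intros [l [Hub Happ]] eps Heps.
    destruct (Happ _ (half_pos eps Heps)) as [P HP].
    destruct (length_on_le_dyadic rho alpha Hrho Hc P _ (half_pos eps Heps)) as [m Hm].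
    exists m. intro k. assert (Hk : dyadic_length rho alpha k <= l) by apply Hub.
    apply CRlt_asym in HP.
    certify ((l - dyadic_length rho alpha k)
      + (length_on rho P alpha - (l - half * eps))
      + (dyadic_length rho alpha m + half * eps - length_on rho P alpha)).
  - intro Hs.
    destruct (stabilizes_supremum _
      (dyadic_length_nondecreasing rho alpha (pm_triangle rho Hrho)) Hs) as [s [Hub Happ]].
    exists s. split.
    + intro P. apply CRle_forall_eps. intros eps Heps.
      destruct (length_on_le_dyadic rho alpha Hrho Hc P eps Heps) as [m Hm].
      specialize (Hub m).
      certify ((s - dyadic_length rho alpha m)
        + (dyadic_length rho alpha m + eps - length_on rho P alpha)).
    + intros eps Heps. destruct (Happ eps Heps) as [m Hm].
      now exists (dyadic_partition m).
Qed.

Lemma dyadic_length_le rho1 rho2 alpha m : (forall x y : X, rho1 x y <= rho2 x y) ->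
  dyadic_length rho1 alpha m <= dyadic_length rho2 alpha m.
Proof. intro H. apply sum_Rle. intros. apply H. Qed.

Lemma dyadic_length_plus rho1 rho2 alpha m :
  dyadic_length (fun x y : X => rho1 x y + rho2 x y) alpha m
  == dyadic_length rho1 alpha m + dyadic_length rho2 alpha m.
Proof. apply (sum_plus (fun i => rho1 _ _) (fun i => rho2 _ _)). Qed.

Lemma dyadic_length_scale c rho alpha m :
  dyadic_length (fun x y : X => c * rho x y) alpha m == c * dyadic_length rho alpha m.
Proof.
  rewrite (CRmult_comm c). unfold dyadic_length, length_on. rewrite <- sum_scale.
  apply CRsum_eq. intros. apply CRmult_comm.
Qed.

Lemma dyadic_length_0 alpha m : dyadic_length (fun _ _ => 0) alpha m == 0.
Proof. apply sum_eq_R0. reflexivity. Qed.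

Lemma dyadic_length_nonneg rho alpha k :
  (forall x y : X, 0 <= rho x y) -> 0 <= dyadic_length rho alpha k.
Proof.
  intro H. apply cond_pos_sum. intro. apply H.
Qed.

Lemma dyadic_length_sum_below (rho : nat -> X -> X -> CRcarrier R) alpha n k :
  dyadic_length (fun x y : X => sum_below (fun i => rho i x y) n) alpha k
  == sum_below (fun i => dyadic_length (rho i) alpha k) n.
Proof.
  induction n as [|n IH]; simpl.
  - apply dyadic_length_0.
  - rewrite (dyadic_length_plus (fun x y : X => sum_below (fun i => rho i x y) n) (rho n)).
    now rewrite IH.
Qed.

End Length.

(** * Plane geometry *)

Lemma norm_nonneg v : 0 <= norm v.
Proof. apply (proj2_sig (CRsqrt_exists _ (inner_self_ge_0 v))). Qed.

Lemma norm_unique v (c : CRcarrier R) : 0 <= c -> c * c == inner v v -> norm v == c.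
Proof.
  intros Hc E. assert (H := norm_nonneg v). rewrite <- norm_sqr in E.
  split; apply CRle_of_squares; try assumption; now apply CRle_of_eq.
Qed.

Lemma inner_le_norms v w : inner v w <= norm v * norm w.
Proof.
  apply CRle_of_squares. { apply CRmult_le_0_compat; apply norm_nonneg. }
  setoid_replace (norm v * norm w * (norm v * norm w))
    with ((norm v * norm v) * (norm w * norm w)) by ring.
  rewrite !norm_sqr. unfold inner.
  certify ((fst v * snd w - snd v * fst w) * (fst v * snd w - snd v * fst w)).
Qed.

Lemma abs_inner_le_norms v w : CRabs R (inner v w) <= norm v * norm w.
Proof.
  apply CRabs_le. split; [|apply inner_le_norms].
  assert (H := inner_le_norms (- fst v, - snd v) w).
  assert (E : norm (- fst v, - snd v) == norm v).
  { apply norm_unique. { apply norm_nonneg. } rewrite norm_sqr. unfold inner. simpl. ring. }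
  rewrite E in H. unfold inner in *. simpl in H.
  certify (norm v * norm w - (- fst v * fst w + - snd v * snd w)).
Qed.

Definition vsub v w : plane R := (fst v - fst w, snd v - snd w).

Lemma dist_sqr v w : dist v w * dist v w == inner (vsub v w) (vsub v w).
Proof. apply norm_sqr. Qed.

Lemma dist_nonneg v w : 0 <= dist v w.
Proof. apply norm_nonneg. Qed.

Lemma dist_pseudometric : pseudometric (@dist R).
Proof.
  split.
  - intro x. apply norm_unique. { apply CRle_refl. } unfold inner. simpl. ring.
  - intros x y. apply norm_unique. { apply dist_nonneg. }
    rewrite dist_sqr. unfold inner. simpl. ring.
  - intros x y z. assert (Hxy := dist_nonneg x y). assert (Hyz := dist_nonneg y z).
    apply CRle_of_squares. { nonneg. }
    assert (H : inner (vsub x y) (vsub y z) <= dist x y * dist y z) by apply inner_le_norms.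
    setoid_replace ((dist x y + dist y z) * (dist x y + dist y z))
      with (dist x y * dist x y + dist y z * dist y z + 2 * (dist x y * dist y z)) by ring.
    rewrite !dist_sqr. unfold inner in *. simpl in *.
    certify (2 * (dist x y * dist y z
      - ((fst x - fst y) * (fst y - fst z) + (snd x - snd y) * (snd y - snd z)))).
Qed.

(** The distance of the projections onto the line through [w], multiplied by the
    norm of [w]. The factor makes it linear in [w] up to the absolute value, as
    the sums over the edges of a polygon require, and gives a meaning to [w = 0]. *)
Definition dist_along w v v' : CRcarrier R := CRabs R (inner (vsub v v') w).

Lemma dist_along_pseudometric w : pseudometric (dist_along w).
Proof.
  unfold dist_along, inner, vsub. split; simpl.
  - intro x. rewrite CRabs_right; [ring|]. apply CRle_of_eq. ring.
  - intros x y. rewrite <- CRabs_opp. apply CRabs_morph. ring.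
  - intros x y z. refine (CRle_trans _ _ _ _ (CRabs_triang _ _)).
    apply CRle_of_eq, CRabs_morph. ring.
Qed.

Lemma dist_along_le w v v' : dist_along w v v' <= dist v v' * norm w.
Proof. apply abs_inner_le_norms. Qed.

Definition unit_vector e : Prop := inner e e == 1.

Lemma norm_unit e : unit_vector e -> norm e == 1.
Proof.
  unfold unit_vector. intro H. apply norm_unique. { nonneg. } rewrite H. ring.
Qed.

Lemma dist_along_unit_le e v v' : unit_vector e -> dist_along e v v' <= dist v v'.
Proof.
  intro H. apply (CRle_trans _ _ _ (dist_along_le e v v')).
  rewrite (norm_unit e H). apply CRle_of_eq. ring.
Qed.

Definition rotate e : plane R := (- snd e, fst e).

Lemma rotate_unit e : unit_vector e -> unit_vector (rotate e).
Proof.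
  unfold unit_vector. intro H. rewrite <- H. unfold inner. simpl. ring.
Qed.

Lemma dist_sqr_frame e v v' : unit_vector e ->
  dist v v' * dist v v' == inner (vsub v v') e * inner (vsub v v') e
    + inner (vsub v v') (rotate e) * inner (vsub v v') (rotate e).
Proof.
  unfold unit_vector. intro H.
  rewrite dist_sqr, <- (CRmult_1_r (inner (vsub v v') (vsub v v'))), <- H.
  unfold inner. simpl. ring.
Qed.

Lemma direction_unit (theta : CRcarrier R) : unit_vector (direction theta).
Proof. unfold unit_vector, inner. simpl. apply CRcos_sin_sqr. Qed.

Lemma dist_projection e (He : nonzero e) v v' : unit_vector e ->
  dist (projection e He v) (projection e He v') == dist_along e v v'.
Proof.
  unfold unit_vector. intro H. apply norm_unique. { apply CRabs_pos. }
  unfold dist_along. rewrite CRabs_square. unfold projection.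
  set (i := CRinv R (inner e e) (inr (inner_self_pos e He))).
  assert (Ei : i == 1).
  { transitivity (inner e e * i). { rewrite H. ring. } apply CRinv_r. }
  unfold inner at 3. simpl. rewrite Ei.
  transitivity (inner (vsub v v') e * inner (vsub v v') e * inner e e).
  { rewrite H. ring. }
  unfold inner. simpl. ring.
Qed.

Lemma dist_along_continuous e (alpha : unit_interval R -> plane R) : unit_vector e ->
  is_path alpha -> continuous (dist_along e) alpha.
Proof.
  intros He H t eps Heps. destruct (H t eps Heps) as [delta [Hd Hc]].
  exists delta. split. { exact Hd. }
  intros u Hu. apply (CRle_lt_trans _ (dist (alpha t) (alpha u))).
  - now apply dist_along_unit_le.
  - now apply Hc.
Qed.

Lemma is_supremum_ext {I : Type} (f g : I -> CRcarrier R) s :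
  (forall i, f i == g i) -> is_supremum f s -> is_supremum g s.
Proof.
  intros E [Hub Happ]. split.
  - intro i. rewrite <- E. apply Hub.
  - intros eps Heps. destruct (Happ eps Heps) as [i Hi]. exists i.
    now apply (CRlt_le_trans _ (f i)), CRle_of_eq.
Qed.

Lemma is_variation_iff (theta l : CRcarrier R) (alpha : unit_interval R -> plane R) :
  iffT (is_variation (direction theta) (direction_nonzero theta) alpha l)
    (is_length (dist_along (direction theta)) alpha l).
Proof.
  assert (E : forall P : partition R,
    length_on dist P (fun t => projection (direction theta) (direction_nonzero theta) (alpha t))
    == length_on (dist_along (direction theta)) P alpha).
  { intro P. apply CRsum_eq. intros. apply dist_projection, direction_unit. }
  split; apply is_supremum_ext; intro P; [|symmetry]; apply E.
Qed.

(** * A polygonal approximation of the Euclidean norm *)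

Section Polygon.

Context (m : nat).
#[local] Notation N := (@INR R (S m)).

Definition inv_den (k : nat) : CRcarrier R :=
  CR_of_Q R (1 # Pos.of_nat (S m * S m + k * k)).

Lemma inv_den_spec k : inv_den k * (N * N + @INR R k * @INR R k) == 1.
Proof.
  unfold inv_den, INR. rewrite <- !CR_of_Q_mult, <- CR_of_Q_plus, <- CR_of_Q_mult.
  apply CR_of_Q_morph. unfold Qeq, Qplus, Qmult. cbn [Qnum Qden].
  rewrite !Pos.mul_1_l, !Pos.mul_1_r, Zpos_of_nat by lia. lia.
Qed.

Lemma inv_den_nonneg k : 0 <= inv_den k.
Proof. apply CR_of_Q_le. discriminate. Qed.

(** The vertex with parameter [k / (m + 1)] in the rational parametrization
    [((1 - t^2) / (1 + t^2), 2 t / (1 + t^2))] of the unit circle. *)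
Definition vertex_x (k : nat) : CRcarrier R := (N * N - @INR R k * @INR R k) * inv_den k.
Definition vertex_y (k : nat) : CRcarrier R := 2 * N * @INR R k * inv_den k.

(** Half of the chord between the vertices [k] and [k + 1] is
    [edge_scale k * (- edge_x k, edge_y k)]. *)
Definition edge_scale (k : nat) : CRcarrier R := N * inv_den k * inv_den (S k).
Definition edge_x (k : nat) : CRcarrier R := N * (2 * @INR R k + 1).
Definition edge_y (k : nat) : CRcarrier R := N * N - @INR R k * (@INR R k + 1).

Lemma vertex_unit k : vertex_x k * vertex_x k + vertex_y k * vertex_y k == 1.
Proof.
  assert (E := inv_den_spec k). unfold vertex_x, vertex_y.
  transitivity ((inv_den k * (N * N + @INR R k * @INR R k))
    * (inv_den k * (N * N + @INR R k * @INR R k))).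
  { ring. }
  rewrite E. ring.
Qed.

Lemma vertex_y_0 : vertex_y 0 == 0.
Proof.
  unfold vertex_y. assert (E : @INR R 0 == 0) by (apply CR_of_Q_morph; reflexivity).
  rewrite E. ring.
Qed.

Lemma vertex_x_diff k : vertex_x k - vertex_x (S k) == 2 * (edge_scale k * edge_x k).
Proof.
  assert (E := inv_den_spec k). assert (E' := inv_den_spec (S k)).
  unfold vertex_x, edge_scale, edge_x. rewrite (INR_S k) in *.
  transitivity ((N * N - @INR R k * @INR R k) * inv_den k
      * (inv_den (S k) * (N * N + (@INR R k + 1) * (@INR R k + 1)))
    - (N * N - (@INR R k + 1) * (@INR R k + 1)) * inv_den (S k)
      * (inv_den k * (N * N + @INR R k * @INR R k))).
  { rewrite E, E'. ring. }
  ring.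
Qed.

Lemma vertex_y_diff k : vertex_y (S k) - vertex_y k == 2 * (edge_scale k * edge_y k).
Proof.
  assert (E := inv_den_spec k). assert (E' := inv_den_spec (S k)).
  unfold vertex_y, edge_scale, edge_y. rewrite (INR_S k) in *.
  transitivity (2 * N * (@INR R k + 1) * inv_den (S k) * (inv_den k * (N * N + @INR R k * @INR R k))
    - 2 * N * @INR R k * inv_den k
      * (inv_den (S k) * (N * N + (@INR R k + 1) * (@INR R k + 1)))).
  { rewrite E, E'. ring. }
  ring.
Qed.

Lemma vertex_inner_le a b nu k : 0 <= nu -> nu * nu == a * a + b * b ->
  vertex_x k * a + vertex_y k * b <= nu.
Proof.
  intros Hnu E. apply CRle_of_squares; [exact Hnu|].
  rewrite <- (CRmult_1_l (nu * nu)), <- (vertex_unit k), E.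
  certify ((vertex_x k * b - vertex_y k * a) * (vertex_x k * b - vertex_y k * a)).
Qed.

Lemma edge_scale_nonneg k : 0 <= edge_scale k.
Proof.
  assert (H1 := inv_den_nonneg k). assert (H2 := inv_den_nonneg (S k)).
  assert (H3 := INR_nonneg (S m)). unfold edge_scale. nonneg.
Qed.

Lemma edge_x_mono j k : (j <= k)%nat -> edge_x j <= edge_x k.
Proof.
  intro H. assert (HN := INR_nonneg (S m)). assert (Hjk := INR_le j k H).
  unfold edge_x. certify (2 * (N * (@INR R k - @INR R j))).
Qed.

Lemma edge_y_mono j k : (j <= k)%nat -> edge_y k <= edge_y j.
Proof.
  intro H. assert (Hj := INR_nonneg j). assert (Hk := INR_nonneg k).
  assert (Hjk := INR_le j k H).
  unfold edge_y. certify ((@INR R k - @INR R j) * (@INR R k + @INR R j + 1)).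
Qed.

Lemma edge_x_nonneg k : 0 <= edge_x k.
Proof.
  assert (HN := INR_nonneg (S m)). assert (Hk := INR_nonneg k). unfold edge_x. nonneg.
Qed.

Lemma edge_y_nonneg k : (k <= m)%nat -> 0 <= edge_y k.
Proof.
  intro H. assert (Hk := INR_nonneg k). assert (HN := INR_nonneg (S m)).
  assert (H1 := INR_le (S k) (S m) ltac:(lia)).
  unfold edge_y. rewrite (INR_S k) in H1.
  apply (CRle_trans _ ((N - (@INR R k + 1)) * N + (@INR R k + 1) * (N - (@INR R k + 1))
    + (@INR R k + 1))).
  - nonneg.
  - apply CRle_of_eq. ring.
Qed.

(** The contribution of the edge [k], taken together with its mirror image, to the
    support function. *)
Definition edge_term a b (k : nat) : CRcarrier R :=
  edge_scale k * (CRabs R (edge_x k * a + edge_y k * b) + CRabs R (edge_x k * a - edge_y k * b)).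

(** The support function at [(a, b)] of the polygon with the vertices
    [(± vertex_x k, ± vertex_y k)] for [k <= m], written as a sum over its edges.
    The first summand is due to the horizontal edge between the vertices
    [(± vertex_x m, vertex_y m)], whose length is of order [1 / m]. *)
Definition polygon_norm a b : CRcarrier R :=
  vertex_x m * CRabs R a + sum_below (edge_term a b) m.

Lemma edge_term_x a b k : 0 <= edge_x k * a -> 0 <= edge_y k * b ->
  edge_y k * b <= edge_x k * a -> edge_term a b k == (vertex_x k - vertex_x (S k)) * a.
Proof.
  intros Ha Hb H. unfold edge_term. rewrite vertex_x_diff.
  rewrite !CRabs_right by nonneg. ring.
Qed.

Lemma edge_term_y a b k : 0 <= edge_x k * a -> 0 <= edge_y k * b ->
  edge_x k * a <= edge_y k * b -> edge_term a b k == (vertex_y (S k) - vertex_y k) * b.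
Proof.
  intros Ha Hb H. unfold edge_term. rewrite vertex_y_diff.
  rewrite (CRabs_right (_ + _)) by nonneg. rewrite CRabs_left. { ring. }
  certify (edge_y k * b - edge_x k * a).
Qed.

(** The edges are ordered by slope: those that contribute their vertical extent
    precede those that contribute their horizontal extent, and the sum telescopes
    to the inner product with the vertex where the two kinds meet. In the
    induction from the last edge backwards, an edge of the first kind is added to
    the estimate for the later ones; one of the second kind is followed only by
    edges of its kind. *)
Lemma polygon_norm_le_quadrant a b nu : 0 <= a -> 0 <= b -> 0 <= nu ->
  nu * nu == a * a + b * b -> polygon_norm a b <= nu.
Proof.
  intros Ha Hb Hnu E.
  assert (H : forall d i, (i + d = m)%nat ->
    vertex_x m * a + (sum_below (edge_term a b) m - sum_below (edge_term a b) i)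
      + vertex_y i * b <= nu).
  { induction d as [|d IH]; intros i Hi.
    - replace i with m by lia.
      apply (CRle_trans _ (vertex_x m * a + vertex_y m * b)).
      + apply CRle_of_eq. ring.
      + now apply vertex_inner_le.
    - assert (Hx : forall k, 0 <= edge_x k * a).
      { intro k. assert (H := edge_x_nonneg k). nonneg. }
      assert (Hy : forall k, (k <= m)%nat -> 0 <= edge_y k * b).
      { intros k Hk. assert (H := edge_y_nonneg k Hk). nonneg. }
      apply (CRle_cases (edge_x i * a) (edge_y i * b)); intro Hc.
      + refine (CRle_trans _ _ _ _ (IH (S i) ltac:(lia))). simpl sum_below.
        rewrite (edge_term_y a b i) by (try apply Hx; try apply Hy; try assumption; lia).
        apply CRle_of_eq. ring.
      + assert (Ht : forall k, (i <= k < m)%nat ->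
          edge_term a b k == vertex_x k * a - vertex_x (S k) * a).
        { intros k Hk. rewrite edge_term_x; [ring | apply Hx | apply Hy; lia |].
          apply (CRle_trans _ (edge_y i * b)).
          - apply CRmult_le_compat_r; [exact Hb | apply edge_y_mono; lia].
          - apply (CRle_trans _ _ _ Hc).
            apply CRmult_le_compat_r; [exact Ha | apply edge_x_mono; lia]. }
        rewrite (sum_below_telescope _ (fun k => vertex_x k * a) i m ltac:(lia) Ht).
        apply (CRle_trans _ (vertex_x i * a + vertex_y i * b)).
        * apply CRle_of_eq. ring.
        * now apply vertex_inner_le. }
  specialize (H m O eq_refl). rewrite vertex_y_0 in H. simpl in H.
  refine (CRle_trans _ _ _ _ H). unfold polygon_norm. rewrite (CRabs_right a) by exact Ha.
  apply CRle_of_eq. ring.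
Qed.

Lemma edge_term_ge_x a b k : (vertex_x k - vertex_x (S k)) * a <= edge_term a b k.
Proof.
  unfold edge_term. rewrite vertex_x_diff. assert (Hs := edge_scale_nonneg k).
  assert (H1 := CRle_abs (edge_x k * a + edge_y k * b)).
  assert (H2 := CRle_abs (edge_x k * a - edge_y k * b)).
  certify (edge_scale k * ((CRabs R (edge_x k * a + edge_y k * b) - (edge_x k * a + edge_y k * b))
    + (CRabs R (edge_x k * a - edge_y k * b) - (edge_x k * a - edge_y k * b)))).
Qed.

Lemma edge_term_ge_y a b k : (vertex_y (S k) - vertex_y k) * b <= edge_term a b k.
Proof.
  unfold edge_term. rewrite vertex_y_diff. assert (Hs := edge_scale_nonneg k).
  assert (H1 := CRle_abs (edge_x k * a + edge_y k * b)).
  assert (H2 := CRle_abs (- (edge_x k * a - edge_y k * b))).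
  rewrite CRabs_opp in H2.
  certify (edge_scale k * ((CRabs R (edge_x k * a + edge_y k * b) - (edge_x k * a + edge_y k * b))
    + (CRabs R (edge_x k * a - edge_y k * b) - - (edge_x k * a - edge_y k * b)))).
Qed.

(** Bound the edges before the vertex [j] from below by their vertical extent,
    and those after it by their horizontal extent. *)
Lemma vertex_inner_le_polygon_norm a b j : (j <= m)%nat -> 0 <= a ->
  vertex_x j * a + vertex_y j * b <= polygon_norm a b.
Proof.
  intros Hj Ha. unfold polygon_norm. rewrite (CRabs_right a) by exact Ha.
  assert (H1 : vertex_y j * b <= sum_below (edge_term a b) j).
  { clear Hj. induction j as [|j IH]; simpl.
    - rewrite vertex_y_0. apply CRle_of_eq. ring.
    - assert (H := edge_term_ge_y a b j).
      certify ((sum_below (edge_term a b) j - vertex_y j * b)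
        + (edge_term a b j - (vertex_y (S j) - vertex_y j) * b)). }
  assert (H2 : forall k, (j <= k)%nat ->
    sum_below (edge_term a b) j + (vertex_x j - vertex_x k) * a <= sum_below (edge_term a b) k).
  { induction 1 as [|k Hjk IH].
    - apply CRle_of_eq. ring.
    - assert (H := edge_term_ge_x a b k). simpl.
      certify ((sum_below (edge_term a b) k
          - (sum_below (edge_term a b) j + (vertex_x j - vertex_x k) * a))
        + (edge_term a b k - (vertex_x k - vertex_x (S k)) * a)). }
  specialize (H2 m Hj).
  certify ((sum_below (edge_term a b) m
      - (sum_below (edge_term a b) j + (vertex_x j - vertex_x m) * a))
    + (sum_below (edge_term a b) j - vertex_y j * b)).
Qed.

Lemma grid_floor a b : 0 <= b -> b <= a ->
  ~ ~ exists j, (j <= m)%nat /\ @INR R j * a <= N * b <= (@INR R j + 1) * a.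
Proof.
  intros Hb Hba.
  assert (H : forall d j, (j + d = m)%nat -> @INR R j * a <= N * b ->
    ~ ~ exists j, (j <= m)%nat /\ @INR R j * a <= N * b <= (@INR R j + 1) * a).
  { induction d as [|d IH]; intros j Hj Hle HF.
    - apply HF. exists m. replace j with m in Hle by lia.
      split. { lia. } split. { exact Hle. }
      rewrite <- INR_S. apply CRmult_le_compat_l. { apply INR_nonneg. } exact Hba.
    - apply (CRle_not_not_total (N * b) ((@INR R j + 1) * a)). intros [H|H].
      + apply HF. exists j. split. { lia. } now split.
      + apply (IH (S j) ltac:(lia)); [|exact HF]. rewrite (INR_S j). exact H. }
  apply (H m O eq_refl).
  assert (HN := INR_nonneg (S m)).
  apply (CRle_trans _ 0); [|nonneg]. apply CRle_of_eq. unfold INR.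
  setoid_replace (CR_of_Q R (Z.of_nat 0 # 1)) with (CR_of_Q R 0)
    by (apply CR_of_Q_morph; reflexivity).
  ring.
Qed.

(** Some vertex is so close to the direction of [(a, b)] that it misses the norm
    by a relative error of order [1 / m^2]. With [D := nu + a], the tangent of
    half the angle of [(a, b)] is [b / D], and [D (N^2 + j^2)] times the deficit at
    the vertex [j] is [(j D - N b)^2], where [|j D - N b| <= D] for a suitable [j]. *)
Lemma polygon_norm_ge_quadrant a b nu : 0 <= a -> 0 <= b -> 0 <= nu ->
  nu * nu == a * a + b * b -> N * N * (nu - polygon_norm a b) <= 2 * nu.
Proof.
  intros Ha Hb Hnu E.
  assert (Hbnu : b <= nu).
  { apply CRle_of_squares. { exact Hnu. } rewrite E. certify (a * a). }
  assert (Hanu : a <= nu).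
  { apply CRle_of_squares. { exact Hnu. } rewrite E. certify (b * b). }
  assert (HN := INR_nonneg (S m)).
  apply (CRle_stable _ _ _ (grid_floor (nu + a) b Hb
    (CRle_trans _ _ _ Hbnu (Rplus_le_pos nu a Ha)))).
  intros (j & Hj & H1 & H2).
  assert (HP := vertex_inner_le_polygon_norm a b j Hj Ha).
  set (c := vertex_x j * a + vertex_y j * b) in *.
  assert (Hc : c <= nu) by now apply vertex_inner_le.
  assert (Hj0 := INR_nonneg j).
  set (D := nu + a) in *. set (z := (N * N + @INR R j * @INR R j) * (nu - c)).
  assert (HDz : D * z <= D * D).
  { set (d := N * b - @INR R j * D).
    assert (Ez : D * z == d * d).
    { assert (Ec : (N * N + @INR R j * @INR R j) * c
        == (N * N - @INR R j * @INR R j) * a + 2 * N * @INR R j * b).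
      { unfold c, vertex_x, vertex_y.
        transitivity ((inv_den j * (N * N + @INR R j * @INR R j))
          * ((N * N - @INR R j * @INR R j) * a + 2 * N * @INR R j * b)). { ring. }
        rewrite inv_den_spec. ring. }
      transitivity (D * ((N * N + @INR R j * @INR R j) * nu - (N * N + @INR R j * @INR R j) * c)).
      { unfold z. ring. }
      rewrite Ec. unfold D, d.
      transitivity (N * N * (nu * nu - a * a) + @INR R j * @INR R j * ((nu + a) * (nu + a))
        - 2 * N * @INR R j * b * (nu + a)). { ring. }
      rewrite E. unfold D. ring. }
    rewrite Ez. unfold d. apply CRsquare_le; [nonneg|].
    certify ((@INR R j + 1) * D - N * b). }
  assert (HzD : z <= D).
  { intro Hlt.
    (* [D] cannot be cancelled unless it is positive. But if it is not, then [nu],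
       [a] and [b] vanish, and so does [z]. *)
    assert (HD : D <= 0).
    { intro HD. exact (CRmult_le_reg_l D z D HD HDz Hlt). }
    unfold D in HD. revert Hlt. change (z <= D).
    assert (Hnu0 : nu == 0). { split; [exact Hnu|]. certify (a + (0 - (nu + a))). }
    assert (Ea : a == 0). { split; [exact Ha|]. rewrite <- Hnu0. exact Hanu. }
    assert (Eb : b == 0). { split; [exact Hb|]. rewrite <- Hnu0. exact Hbnu. }
    unfold z, c, D. rewrite Hnu0, Ea, Eb. apply CRle_of_eq. ring. }
  unfold z, D in HzD.
  certify (N * N * (polygon_norm a b - c) + @INR R j * @INR R j * (nu - c)
    + (nu + a - (N * N + @INR R j * @INR R j) * (nu - c)) + (nu - a)).
Qed.

Lemma edge_term_abs a b k : edge_term (CRabs R a) (CRabs R b) k == edge_term a b k.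
Proof.
  unfold edge_term. set (p := edge_x k). set (q := edge_y k).
  apply CRmult_morph; [reflexivity|].
  transitivity (CRabs R (p * CRabs R a + q * b) + CRabs R (p * CRabs R a - q * b)).
  - apply (CReq_cases 0 b); intro Hb.
    + rewrite (CRabs_right b Hb). reflexivity.
    + rewrite (CRabs_left b Hb), CRplus_comm.
      apply CRplus_morph; apply CRabs_morph; ring.
  - apply (CReq_cases 0 a); intro Ha.
    + rewrite (CRabs_right a Ha). reflexivity.
    + rewrite (CRabs_left a Ha), CRplus_comm.
      apply CRplus_morph; rewrite <- CRabs_opp; apply CRabs_morph; ring.
Qed.

Lemma polygon_norm_abs a b : polygon_norm (CRabs R a) (CRabs R b) == polygon_norm a b.
Proof.
  unfold polygon_norm. rewrite (CRabs_right (CRabs R a)) by apply CRabs_pos.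
  apply CRplus_morph; [reflexivity|].
  apply sum_below_ext. intros. apply edge_term_abs.
Qed.

Lemma vertex_x_last : 1 <= N * vertex_x m.
Proof.
  assert (E := inv_den_spec m). assert (H := inv_den_nonneg m). assert (Hm := INR_nonneg m).
  unfold vertex_x. rewrite (INR_S m) in *.
  apply (CRle_trans _ _ _ (CRle_of_eq _ _ (CReq_sym _ _ E))).
  certify (inv_den m * @INR R m).
Qed.

Lemma vertex_x_last_nonneg : 0 <= vertex_x m.
Proof.
  assert (H := inv_den_nonneg m). assert (Hm := INR_nonneg m).
  unfold vertex_x. rewrite (INR_S m). certify ((2 * @INR R m + 1) * inv_den m).
Qed.

Theorem polygon_norm_bounds a b nu : 0 <= nu -> nu * nu == a * a + b * b ->
  polygon_norm a b <= nu /\ N * N * (nu - polygon_norm a b) <= 2 * nu.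
Proof.
  intros Hnu E. rewrite <- polygon_norm_abs.
  assert (Ha := CRabs_pos a). assert (Hb := CRabs_pos b).
  rewrite <- (CRabs_square a), <- (CRabs_square b) in E.
  split; [now apply polygon_norm_le_quadrant | now apply polygon_norm_ge_quadrant].
Qed.

End Polygon.

(** The vectors [a e + b e'], where [e'] is [e] turned by a right angle. *)
Definition frame (e : plane R) (a b : CRcarrier R) : plane R :=
  (a * fst e + b * fst (rotate e), a * snd e + b * snd (rotate e)).

(** The polygon norm in the frame of [e], without the summand of the horizontal
    edge, which is a multiple of [dist_along e]. *)
Definition slanted_dist (m : nat) (e v v' : plane R) : CRcarrier R :=
  sum_below (fun k => edge_scale m k
    * (dist_along (frame e (edge_x m k) (edge_y m k)) v v'
       + dist_along (frame e (edge_x m k) (- edge_y m k)) v v')) m.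

Theorem slanted_dist_bounds (m : nat) (e v v' : plane R) : unit_vector e ->
  vertex_x m m * dist_along e v v' + slanted_dist m e v v' <= dist v v'
  /\ INR (S m) * INR (S m)
    * (dist v v' - (vertex_x m m * dist_along e v v' + slanted_dist m e v v')) <= 2 * dist v v'.
Proof.
  intro He.
  assert (E : vertex_x m m * dist_along e v v' + slanted_dist m e v v'
    == polygon_norm m (inner (vsub v v') e) (inner (vsub v v') (rotate e))).
  { apply CRplus_morph; [reflexivity|]. apply sum_below_ext. intros k _.
    apply CRmult_morph; [reflexivity|].
    apply CRplus_morph; apply CRabs_morph; unfold inner, frame; simpl; ring. }
  rewrite E. apply polygon_norm_bounds. { apply dist_nonneg. } now apply dist_sqr_frame.
Qed.

Lemma slanted_dist_triangular m e : triangular (slanted_dist m e).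
Proof.
  apply (triangular_sum (fun k v v' => edge_scale m k
    * (dist_along (frame e (edge_x m k) (edge_y m k)) v v'
       + dist_along (frame e (edge_x m k) (- edge_y m k)) v v'))).
  intro k. apply (triangular_scale _ (fun v v' =>
    dist_along (frame e (edge_x m k) (edge_y m k)) v v'
    + dist_along (frame e (edge_x m k) (- edge_y m k)) v v')).
  { apply edge_scale_nonneg. }
  apply triangular_plus; apply dist_along_pseudometric.
Qed.

(** * Directions *)

Lemma series_tail_bound (u : nat -> CRcarrier R) l n M : series_cv u l -> 0 <= M ->
  (forall k, CRabs R (u (S n + k)%nat) <= CRpow half k * M) ->
  CRabs R (l - CRsum u n) <= 2 * M.
Proof.
  intros Hl HM Hu.
  assert (Hcv : CR_cv R (fun j => CRsum u (j + S n)%nat - CRsum u n) (l - CRsum u n)).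
  { apply CR_cv_minus; [|apply CR_cv_const]. now apply (CR_cv_shift' (CRsum u)). }
  apply (CR_cv_bound_up _ _ _ O) with (2 := CR_cv_abs_cont _ _ Hcv).
  intros p _. replace (p + S n)%nat with (S n + p)%nat by lia. rewrite sum_assoc.
  setoid_replace (CRsum u n + CRsum (fun k => u (S n + k)%nat) p - CRsum u n)
    with (CRsum (fun k => u (S n + k)%nat) p) by ring.
  apply (CRle_trans _ _ _ (multiTriangleIneg _ _)).
  refine (CRle_trans _ _ _ _ (CRsum_geo_le M p HM)).
  apply sum_Rle. intros. apply Hu.
Qed.

Lemma exp_term_nonneg x n : 0 <= x -> 0 <= CRexp_term x n.
Proof.
  intro H. apply CRmult_le_0_compat. { apply CR_of_Q_le. discriminate. }
  now apply CRpow_ge_zero.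
Qed.

Lemma exp_term_mono x y n : 0 <= x -> x <= y -> CRexp_term x n <= CRexp_term y n.
Proof.
  intros H1 H2. apply CRmult_le_compat_l. { apply CR_of_Q_le. discriminate. }
  now apply CRpow_le.
Qed.

(** The derivative of the term [n + 1] is the term [n], which is at most its value
    at [2]. The
    estimate is obtained from the recursion for the terms instead. *)
Lemma exp_term_lipschitz x y n : 0 <= x <= 2 -> 0 <= y <= 2 ->
  CRabs R (CRexp_term x (S n) - CRexp_term y (S n)) <= CRabs R (x - y) * CRexp_term 2 n.
Proof.
  intros [Hx Hx2] [Hy Hy2].
  assert (Hstep : forall k,
    INR (S k) * CRabs R (CRexp_term x (S k) - CRexp_term y (S k))
    <= CRabs R (x - y) * CRexp_term 2 k + 2 * CRabs R (CRexp_term x k - CRexp_term y k)).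
  { intro k. rewrite <- (CRabs_right (INR (S k))) by apply INR_nonneg.
    rewrite <- CRabs_mult.
    setoid_replace (INR (S k) * (CRexp_term x (S k) - CRexp_term y (S k)))
      with (INR (S k) * CRexp_term x (S k) - INR (S k) * CRexp_term y (S k)) by ring.
    rewrite !CRexp_term_S.
    setoid_replace (x * CRexp_term x k - y * CRexp_term y k)
      with ((x - y) * CRexp_term x k + y * (CRexp_term x k - CRexp_term y k)) by ring.
    apply (CRle_trans _ _ _ (CRabs_triang _ _)). rewrite !CRabs_mult.
    rewrite (CRabs_right (CRexp_term x k)) by now apply exp_term_nonneg.
    rewrite (CRabs_right y) by exact Hy.
    apply CRplus_le_compat.
    - apply CRmult_le_compat_l. { apply CRabs_pos. } now apply exp_term_mono.
    - apply CRmult_le_compat_r. { apply CRabs_pos. } exact Hy2. }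
  induction n as [|n IH].
  - specialize (Hstep O). rewrite !CRexp_term_0 in *.
    assert (E : @INR R 1 == 1) by reflexivity. rewrite E in Hstep.
    assert (E0 : CRabs R (1 - 1) == 0).
    { rewrite CRabs_right; [|apply CRle_of_eq]; ring. }
    rewrite E0 in Hstep.
    certify (CRabs R (x - y) * 1 + 2 * 0 - 1 * CRabs R (CRexp_term x 1 - CRexp_term y 1)).
  - apply (CRmult_le_reg_l (INR (S (S n)))). { apply INR_S_pos. }
    apply (CRle_trans _ _ _ (Hstep (S n))).
    setoid_replace (INR (S (S n)) * (CRabs R (x - y) * CRexp_term 2 (S n)))
      with (CRabs R (x - y) * CRexp_term 2 (S n)
        + CRabs R (x - y) * (INR (S n) * CRexp_term 2 (S n)))
      by (rewrite (INR_S (S n)); ring).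
    rewrite CRexp_term_S.
    certify (2 * (CRabs R (x - y) * CRexp_term 2 n
      - CRabs R (CRexp_term x (S n) - CRexp_term y (S n)))).
Qed.

Lemma alternating_lipschitz (f : nat -> nat) : (forall k, (k <= pred (f k))%nat) ->
  { C : CRcarrier R | 0 <= C /\ forall x y l l',
      0 <= x <= 2 -> 0 <= y <= 2 ->
      series_cv (fun k => CRpow (CRopp R 1) k * CRexp_term x (f k)) l ->
      series_cv (fun k => CRpow (CRopp R 1) k * CRexp_term y (f k)) l' ->
      CRabs R (l - l') <= C * CRabs R (x - y) }.
Proof.
  intro Hf. destruct (CRexp_term_bound (CR_of_Q R 2)) as [K [HK Hb]].
  exists (2 * K). split. { nonneg. } intros x y l l' Hx Hy Hl Hl'.
  assert (Hcv := CR_cv_abs_cont _ _ (series_cv_minus _ _ _ _ Hl Hl')).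
  apply (CR_cv_bound_up _ _ _ O) with (2 := Hcv). intros n _.
  apply (CRle_trans _ _ _ (multiTriangleIneg _ _)).
  setoid_replace (2 * K * CRabs R (x - y)) with (2 * (CRabs R (x - y) * K)) by ring.
  refine (CRle_trans _ _ _ _ (CRsum_geo_le _ n _)). 2:{ assert (H := CRabs_pos (x - y)). nonneg. }
  apply sum_Rle. intros k _.
  setoid_replace (CRpow (- (1)) k * CRexp_term x (f k) - CRpow (- (1)) k * CRexp_term y (f k))
    with (CRpow (- (1)) k * (CRexp_term x (f k) - CRexp_term y (f k))) by ring.
  rewrite CRabs_mult, CRabs_sign, CRmult_1_l.
  assert (H0 := CRabs_pos (x - y)). assert (Hh := @CRhalf_pow_ge_0 R k).
  specialize (Hf k). destruct (f k) as [|j].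
  - rewrite !CRexp_term_0.
    setoid_replace (CR_of_Q R 1 - 1) with (CR_of_Q R 0) by ring.
    rewrite CRabs_right by apply CRle_refl. nonneg.
  - apply (CRle_trans _ _ _ (exp_term_lipschitz x y j Hx Hy)).
    assert (H1 := CRle_trans _ _ _ (CRle_abs _) (Hb j)).
    assert (H2 := @CRhalf_pow_le R k j Hf).
    set (hj := CRpow half j) in *. set (hk := CRpow half k) in *.
    certify (CRabs R (x - y) * ((hj * K - CRexp_term 2 j) + (hk - hj) * K)).
Qed.

Lemma cos_sin_lipschitz : { C : CRcarrier R | 0 <= C /\ forall x y,
  0 <= x <= 2 -> 0 <= y <= 2 ->
  CRabs R (CRcos x - CRcos y) <= C * CRabs R (x - y)
  /\ CRabs R (CRsin x - CRsin y) <= C * CRabs R (x - y) }.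
Proof.
  destruct (alternating_lipschitz (fun k => 2 * k)%nat) as [C1 [HC1 H1]]. { intro. lia. }
  destruct (alternating_lipschitz (fun k => 2 * k + 1)%nat) as [C2 [HC2 H2]]. { intro. lia. }
  exists (C1 + C2). split. { nonneg. } intros x y Hx Hy.
  specialize (H1 x y _ _ Hx Hy (projT2 (CRcos_exists x)) (projT2 (CRcos_exists y))).
  specialize (H2 x y _ _ Hx Hy (projT2 (CRsin_exists x)) (projT2 (CRsin_exists y))).
  fold (CRcos x) (CRcos y) in H1. fold (CRsin x) (CRsin y) in H2.
  split.
  - certify (C1 * CRabs R (x - y) - CRabs R (CRcos x - CRcos y) + C2 * CRabs R (x - y)).
  - certify (C2 * CRabs R (x - y) - CRabs R (CRsin x - CRsin y) + C1 * CRabs R (x - y)).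
Qed.

Lemma exp_term_zero n : CRexp_term (CR_of_Q R 0) (S n) == 0.
Proof. unfold CRexp_term. simpl. ring. Qed.

Lemma cos_0 : CRcos (CR_of_Q R 0) == 1.
Proof.
  assert (H : CRabs R (CRcos (CR_of_Q R 0) - CRsum (CRcos_term 0) 0) <= 2 * 0).
  { apply series_tail_bound. { apply (projT2 (CRcos_exists _)). } { apply CRle_refl. }
    intro k. apply CRle_of_eq. unfold CRcos_term.
    replace (2 * (1 + k))%nat with (S (S (2 * k))) by lia.
    rewrite exp_term_zero, CRabs_right; [ring | apply CRle_of_eq; ring]. }
  simpl in H. unfold CRcos_term in H. simpl in H. rewrite CRexp_term_0 in H.
  destruct (CRabs_def2 _ _ H) as [H1 H2].
  split.
  - certify (CRcos (CR_of_Q R 0) - 1 * 1 - - (2 * 0)).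
  - certify (2 * 0 - (CRcos (CR_of_Q R 0) - 1 * 1)).
Qed.

Lemma sin_0 : CRsin (CR_of_Q R 0) == 0.
Proof.
  assert (H : CRabs R (CRsin (CR_of_Q R 0) - CRsum (CRsin_term 0) 0) <= 2 * 0).
  { apply series_tail_bound. { apply (projT2 (CRsin_exists _)). } { apply CRle_refl. }
    intro k. apply CRle_of_eq. unfold CRsin_term.
    replace (2 * (1 + k) + 1)%nat with (S (S (S (2 * k)))) by lia.
    rewrite exp_term_zero, CRabs_right; [ring | apply CRle_of_eq; ring]. }
  simpl in H. unfold CRsin_term in H. simpl in H. rewrite exp_term_zero in H.
  destruct (CRabs_def2 _ _ H) as [H1 H2].
  split.
  - certify (CRsin (CR_of_Q R 0) - 1 * 0 - - (2 * 0)).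
  - certify (2 * 0 - (CRsin (CR_of_Q R 0) - 1 * 0)).
Qed.

Lemma exp_term_2_decay n k : (3 <= n)%nat ->
  CRexp_term (CR_of_Q R 2) (n + k) <= CRpow half k * CRexp_term 2 n.
Proof.
  intro Hn. induction k as [|k IH].
  - rewrite Nat.add_0_r. simpl. apply CRle_of_eq. ring.
  - apply (CRle_trans _ (half * CRexp_term 2 (n + k))).
    + rewrite Nat.add_succ_r.
      apply (CRmult_le_reg_l (INR (S (n + k)))). { apply INR_S_pos. }
      rewrite CRexp_term_S.
      assert (H4 : INR 4 <= @INR R (S (n + k))) by (apply INR_le; lia).
      assert (E4 : @INR R 4 == 4) by reflexivity. rewrite E4 in H4.
      assert (H0 := exp_term_nonneg 2 (n + k) ltac:(nonneg)).
      certify (half * ((INR (S (n + k)) - 4) * CRexp_term 2 (n + k))).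
    + simpl. rewrite CRmult_assoc. apply CRmult_le_compat_l; [nonneg | exact IH].
Qed.

(** The partial sum [1 - 2 + 2/3] is [-1/3], and the tail is at most [8/45]. *)
Lemma cos_2_nonpos : CRcos (CR_of_Q R 2) <= 0.
Proof.
  assert (E4 : CRexp_term (CR_of_Q R 2) 4 == CR_of_Q R (2#3)).
  { unfold CRexp_term. change (Pos.of_nat (fact 4)) with 24%positive. simpl. ring. }
  assert (E2 : CRexp_term (CR_of_Q R 2) 2 == CR_of_Q R 2).
  { unfold CRexp_term. change (Pos.of_nat (fact 2)) with 2%positive. simpl. ring. }
  assert (E6 : CRexp_term (CR_of_Q R 2) 6 == CR_of_Q R (4#45)).
  { unfold CRexp_term. change (Pos.of_nat (fact 6)) with 720%positive. simpl. ring. }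
  assert (H : CRabs R (CRcos (CR_of_Q R 2) - CRsum (CRcos_term 2) 2) <= 2 * CR_of_Q R (4#45)).
  { apply series_tail_bound. { apply (projT2 (CRcos_exists _)). } { nonneg. }
    intro k. unfold CRcos_term. rewrite CRabs_mult, CRabs_sign, CRmult_1_l.
    rewrite CRabs_right by (apply exp_term_nonneg; nonneg).
    replace (2 * (3 + k))%nat with (6 + 2 * k)%nat by lia.
    apply (CRle_trans _ _ _ (exp_term_2_decay 6 (2 * k) ltac:(lia))).
    rewrite E6. apply CRmult_le_compat_r. { nonneg. } apply CRhalf_pow_le. lia. }
  assert (ES : CRsum (CRcos_term (CR_of_Q R 2)) 2 == CR_of_Q R (-1#3)).
  { cbn [CRsum]. unfold CRcos_term. cbn [Nat.mul Nat.add].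
    rewrite CRexp_term_0, E2, E4. simpl. ring. }
  rewrite ES in H. destruct (CRabs_def2 _ _ H) as [H1 _].
  certify (2 * CR_of_Q R (4#45) - (CRcos (CR_of_Q R 2) - CR_of_Q R (-1#3)) + CR_of_Q R (7#45)).
Qed.

(** The partial sum [2 - 4/3] is [2/3], and the tail is at most [8/15]. *)
Lemma sin_2_nonneg : 0 <= CRsin (CR_of_Q R 2).
Proof.
  assert (E1 : CRexp_term (CR_of_Q R 2) 1 == CR_of_Q R 2).
  { unfold CRexp_term. change (Pos.of_nat (fact 1)) with 1%positive. simpl. ring. }
  assert (E3 : CRexp_term (CR_of_Q R 2) 3 == CR_of_Q R (4#3)).
  { unfold CRexp_term. change (Pos.of_nat (fact 3)) with 6%positive. simpl. ring. }
  assert (E5 : CRexp_term (CR_of_Q R 2) 5 == CR_of_Q R (4#15)).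
  { unfold CRexp_term. change (Pos.of_nat (fact 5)) with 120%positive. simpl. ring. }
  assert (H : CRabs R (CRsin (CR_of_Q R 2) - CRsum (CRsin_term 2) 1) <= 2 * CR_of_Q R (4#15)).
  { apply series_tail_bound. { apply (projT2 (CRsin_exists _)). } { nonneg. }
    intro k. unfold CRsin_term. rewrite CRabs_mult, CRabs_sign, CRmult_1_l.
    rewrite CRabs_right by (apply exp_term_nonneg; nonneg).
    replace (2 * (2 + k) + 1)%nat with (5 + 2 * k)%nat by lia.
    apply (CRle_trans _ _ _ (exp_term_2_decay 5 (2 * k) ltac:(lia))).
    rewrite E5. apply CRmult_le_compat_r. { nonneg. } apply CRhalf_pow_le. lia. }
  assert (ES : CRsum (CRsin_term (CR_of_Q R 2)) 1 == CR_of_Q R (2#3)).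
  { cbn [CRsum]. unfold CRsin_term. cbn [Nat.mul Nat.add].
    rewrite E1, E3. simpl. ring. }
  rewrite ES in H. destruct (CRabs_def2 _ _ H) as [_ H2].
  certify (CRsin (CR_of_Q R 2) - CR_of_Q R (2#3) - - (2 * CR_of_Q R (4#15)) + CR_of_Q R (2#15)).
Qed.

Lemma exp_term_opp x n : CRexp_term (- x) n == CRpow (CRopp R 1) n * CRexp_term x n.
Proof.
  unfold CRexp_term.
  assert (E : CRpow (- x) n == CRpow (CRopp R 1) n * CRpow x n).
  { rewrite CRpow_mult. apply CRpow_proper. ring. }
  rewrite E. ring.
Qed.

Lemma pow_opp_1_even k : CRpow (CRopp R 1) (2 * k) == 1.
Proof.
  induction k as [|k IH]. { reflexivity. }
  replace (2 * S k)%nat with (S (S (2 * k))) by lia.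
  change (- (1) * (- (1) * CRpow (CRopp R 1) (2 * k)) == 1). rewrite IH. ring.
Qed.

Lemma cos_opp x : CRcos (- x) == CRcos x.
Proof.
  refine (series_cv_unique _ _ _ (projT2 (CRcos_exists (- x))) _).
  apply (series_cv_eq (CRcos_term x)); [|apply (projT2 (CRcos_exists x))].
  intro k. unfold CRcos_term. rewrite exp_term_opp, pow_opp_1_even. ring.
Qed.

Lemma sin_opp x : CRsin (- x) == - CRsin x.
Proof.
  refine (series_cv_unique _ _ _ (projT2 (CRsin_exists (- x))) _).
  apply (series_cv_eq (fun k => - CRsin_term x k)).
  2:{ apply series_cv_opp, (projT2 (CRsin_exists x)). }
  intro k. unfold CRsin_term. rewrite exp_term_opp, Nat.add_1_r.
  change (CRpow (CRopp R 1) (S (2 * k))) with (- (1) * CRpow (CRopp R 1) (2 * k)).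
  rewrite pow_opp_1_even. ring.
Qed.

(** An intermediate value argument for small steps. As [delta < eps], each value can
    be found to be less than [eps] or greater than [delta], and in the latter
    case the next value is still positive. *)
Lemma approximate_zero (f : nat -> CRcarrier R) n delta eps : delta < eps -> 0 <= eps ->
  0 <= f O -> f n <= 0 ->
  (forall i, (i < n)%nat -> CRabs R (f (S i) - f i) <= delta) ->
  { i : nat | (i <= n)%nat /\ CRabs R (f i) <= eps }.
Proof.
  intros Hde Heps. revert f. induction n as [|n IH]; intros f H0 Hn Hstep.
  - exists O. split. { lia. } rewrite CRabs_right by exact H0.
    now apply (CRle_trans _ 0).
  - destruct (snd (CRltLinear R) delta (f O) eps Hde) as [H|H].
    + destruct (IH (fun i => f (S i))) as [i [Hi Hfi]].
      * destruct (CRabs_def2 _ _ (Hstep O ltac:(lia))) as [_ H2].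
        apply CRlt_asym in H.
        certify ((f 1%nat - f O - - delta) + (f O - delta)).
      * exact Hn.
      * intros i Hi. apply Hstep. lia.
      * exists (S i). split; [lia | exact Hfi].
    + exists O. split. { lia. } rewrite CRabs_right by exact H0. now apply CRlt_asym.
Qed.

(** As [t] runs from [0] to [2], the component of [(p, q)] orthogonal to
    [direction t] changes from [q] to [- p sin 2 + q cos 2], which is not positive. *)
Lemma direction_quadrant p q eps : 0 <= p -> 0 <= q -> 0 < eps ->
  { theta : CRcarrier R | CRabs R (inner (p, q) (rotate (direction theta))) <= eps }.
Proof.
  intros Hp Hq Heps.
  destruct cos_sin_lipschitz as [C [HC HL]].
  set (g := fun t => inner (p, q) (rotate (direction t))).
  assert (Hg : forall x y, 0 <= x <= 2 -> 0 <= y <= 2 ->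
    CRabs R (g x - g y) <= (p + q) * C * CRabs R (x - y)).
  { intros x y Hx Hy. destruct (HL x y Hx Hy) as [H1 H2].
    unfold g, inner. simpl.
    setoid_replace (p * - CRsin x + q * CRcos x - (p * - CRsin y + q * CRcos y))
      with (- (p * (CRsin x - CRsin y)) + q * (CRcos x - CRcos y)) by ring.
    apply (CRle_trans _ _ _ (CRabs_triang _ _)). rewrite CRabs_opp, !CRabs_mult.
    rewrite (CRabs_right p), (CRabs_right q) by assumption.
    certify (p * (C * CRabs R (x - y) - CRabs R (CRsin x - CRsin y))
      + q * (C * CRabs R (x - y) - CRabs R (CRcos x - CRcos y))). }
  assert (Hgeq : forall x y, 0 <= x <= 2 -> 0 <= y <= 2 -> x == y -> g x == g y).
  { intros x y Hx Hy Exy. assert (H := Hg x y Hx Hy).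
    assert (E : CRabs R (x - y) == 0).
    { rewrite Exy, CRabs_right; [|apply CRle_of_eq]; ring. }
    rewrite E in H. destruct (CRabs_def2 _ _ H) as [H1 H2]. split.
    - certify (g x - g y - - ((p + q) * C * 0)).
    - certify ((p + q) * C * 0 - (g x - g y)). }
  destruct (small_factor (2 * ((p + q) * C)) (half * eps)) as [d [Hd HdL]].
  { nonneg. } { now apply half_pos. }
  destruct (dyadic_mesh_small d Hd) as [m Hm].
  set (t := fun i => 2 * CR_of_Q R (dyadic m i)).
  assert (Ht : forall i, (i <= 2 ^ m)%nat -> 0 <= t i <= 2).
  { intros i Hi. assert (H0 := dyadic_le m 0 i ltac:(lia)).
    assert (H1 := dyadic_le m i (2 ^ m) Hi). rewrite dyadic_0 in H0. rewrite dyadic_full in H1.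
    unfold t. split.
    - nonneg.
    - certify (2 * (1 - CR_of_Q R (dyadic m i))). }
  destruct (approximate_zero (fun i => g (t i)) (2 ^ m) (half * eps) eps) as [i [_ Hi]].
  - rewrite <- (CRplus_0_r (half * eps)).
    apply (CRlt_le_trans _ (half * eps + half * eps)).
    + apply CRplus_lt_compat_l. now apply half_pos.
    + apply CRle_of_eq. ring.
  - now apply CRlt_asym.
  - rewrite (Hgeq _ (CR_of_Q R 0)).
    + unfold g, inner. simpl. rewrite cos_0, sin_0.
      apply (CRle_trans _ q _ Hq). apply CRle_of_eq. ring.
    + apply Ht. lia.
    + split; nonneg.
    + unfold t. rewrite dyadic_0. ring.
  - rewrite (Hgeq _ (CR_of_Q R 2)).
    + assert (H1 := cos_2_nonpos). assert (H2 := sin_2_nonneg).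
      unfold g, inner. simpl.
      certify (p * CRsin (CR_of_Q R 2) + q * (0 - CRcos (CR_of_Q R 2))).
    + apply Ht. lia.
    + split; [nonneg | apply CRle_refl].
    + unfold t. rewrite dyadic_full. ring.
  - intros i Hi. apply (CRle_trans _ _ _ (Hg _ _ (Ht (S i) Hi) (Ht i ltac:(lia)))).
    assert (E : t (S i) - t i == 2 * CR_of_Q R (dyadic m 1)).
    { unfold t. rewrite dyadic_S. ring. }
    assert (H0 : 0 <= CR_of_Q R (dyadic m 1)) by (apply CR_of_Q_le; discriminate).
    rewrite E, CRabs_right by nonneg.
    apply CRlt_asym in Hm.
    certify (2 * ((p + q) * C) * (d - CR_of_Q R (dyadic m 1))
      + (half * eps - d * (2 * ((p + q) * C)))).
  - exists (t i). exact Hi.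
Qed.

Lemma direction_fourth_quadrant p q eps : 0 <= p -> 0 <= q -> 0 < eps ->
  { theta : CRcarrier R | CRabs R (inner (p, - q) (rotate (direction theta))) <= eps }.
Proof.
  intros Hp Hq Heps. destruct (direction_quadrant p q eps Hp Hq Heps) as [theta H].
  exists (- theta). rewrite <- CRabs_opp. refine (CRle_trans _ _ _ _ H).
  apply CRle_of_eq, CRabs_morph. unfold inner. simpl. rewrite cos_opp, sin_opp. ring.
Qed.

(** * Length and variations *)

Section Rectifiability.

Context (alpha : unit_interval R -> plane R).
#[local] Notation N m := (@INR R (S m)).

Lemma polygon_length_bounds m e k : unit_vector e ->
  vertex_x m m * dyadic_length (dist_along e) alpha k
    + dyadic_length (slanted_dist m e) alpha k <= dyadic_length dist alpha k
  /\ N m * N m * (dyadic_length dist alpha k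
    - (vertex_x m m * dyadic_length (dist_along e) alpha k
      + dyadic_length (slanted_dist m e) alpha k)) <= 2 * dyadic_length dist alpha k.
Proof.
  intro He. set (c := vertex_x m m).
  assert (E : dyadic_length (fun v v' => c * dist_along e v v' + slanted_dist m e v v') alpha k
    == c * dyadic_length (dist_along e) alpha k + dyadic_length (slanted_dist m e) alpha k).
  { rewrite (dyadic_length_plus (fun v v' => c * dist_along e v v')).
    rewrite (dyadic_length_scale c (dist_along e)). reflexivity. }
  rewrite <- E. split.
  - apply dyadic_length_le. intros v v'. apply (slanted_dist_bounds m e v v' He).
  - set (q := fun v v' => c * dist_along e v v' + slanted_dist m e v v').
    assert (H : dyadic_length (fun v v' => N m * N m * dist v v') alpha k
      <= dyadic_length (fun v v' => 2 * dist v v' + N m * N m * q v v') alpha k).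
    { apply dyadic_length_le. intros v v'.
      destruct (slanted_dist_bounds m e v v' He) as [_ H].
      certify (2 * dist v v' - N m * N m * (dist v v' - q v v')). }
    rewrite (dyadic_length_plus (fun v v' => 2 * dist v v')) in H.
    rewrite (dyadic_length_scale 2 dist), (dyadic_length_scale (N m * N m) dist),
      (dyadic_length_scale (N m * N m) q) in H.
    certify (2 * dyadic_length dist alpha k + N m * N m * dyadic_length q alpha k
      - N m * N m * dyadic_length dist alpha k).
Qed.

Lemma dist_along_length_nondecreasing w : nondecreasing (dyadic_length (dist_along w) alpha).
Proof. apply dyadic_length_nondecreasing, dist_along_pseudometric. Qed.

(** The coefficient of [dist_along e] in the polygon norm is of order [1 / m],
    whereas the relative error of the polygon norm is of order [1 / m^2]. The
    variation for the rest of the polygon norm cannot decrease under refinement.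
    Hence the variation along [e] cannot increase much, once the length of the
    path is nearly attained. *)
Lemma stabilizes_along_unit e : unit_vector e ->
  stabilizes (dyadic_length dist alpha) -> stabilizes (dyadic_length (dist_along e) alpha).
Proof.
  intros He Hs eps Heps. destruct (stabilizes_bounded _ Hs) as [K HK].
  assert (HK0 : 0 <= K).
  { apply (CRle_trans _ _ _ (dyadic_length_nonneg dist alpha 0 dist_nonneg)), HK. }
  destruct (archimedean_factor (2 * K) (half * eps)) as [m Hm]. { nonneg. } { now apply half_pos. }
  assert (HN := INR_nonneg (S m)).
  destruct (small_factor (N m) (half * eps) HN (half_pos eps Heps)) as [d [Hd Hdm]].
  destruct (Hs d Hd) as [j Hj]. exists j. intro k.
  set (u := dyadic_length (dist_along e) alpha) in *. set (l := dyadic_length dist alpha) in *.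
  assert (Hu : nondecreasing u) by apply dist_along_length_nondecreasing.
  apply (CRle_trans _ (u (Nat.max j k))). { apply nondecreasing_le; [exact Hu | lia]. }
  assert (Huj := nondecreasing_le u j (Nat.max j k) Hu ltac:(lia)).
  set (p := Nat.max j k) in *.
  assert (Hg := nondecreasing_le _ j p
    (dyadic_length_nondecreasing _ alpha (slanted_dist_triangular m e)) ltac:(lia)).
  set (g := dyadic_length (slanted_dist m e) alpha) in *.
  destruct (polygon_length_bounds m e p He) as [Hp _].
  destruct (polygon_length_bounds m e j He) as [_ Hj2].
  fold u l g in Hp, Hj2. specialize (Hj p). specialize (HK j).
  assert (Hc := vertex_x_last m).
  set (c := vertex_x m m) in *.
  apply (CRplus_le_reg_l (- u j)).
  apply (CRmult_le_reg_l (N m)). { apply INR_S_pos. }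
  certify ((N m * c - 1) * (N m * (u p - u j)) + N m * N m * (l p - (c * u p + g p))
    + N m * N m * (l j + d - l p) + (2 * l j - N m * N m * (l j - (c * u j + g j)))
    + N m * N m * (g p - g j) + 2 * (K - l j) + (N m * (half * eps) - 2 * K)
    + N m * (half * eps - d * N m)).
Qed.

(** Decompose [w] into components along [e] and orthogonal to [e]. *)
Lemma dist_along_rotate w e v v' : unit_vector e ->
  CRabs R (dist_along w v v' - CRabs R (inner w e) * dist_along e v v')
  <= CRabs R (inner w (rotate e)) * dist v v'.
Proof.
  intro He. unfold dist_along. rewrite <- CRabs_mult.
  apply (CRle_trans _ _ _ (CRabs_triang_inv2 _ _)).
  apply (CRle_trans _ (CRabs R (inner w (rotate e)) * dist_along (rotate e) v v')).
  - unfold dist_along. rewrite <- CRabs_mult. apply CRle_of_eq, CRabs_morph.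
    transitivity (inner (vsub v v') w * inner e e - inner w e * inner (vsub v v') e).
    { rewrite (He : inner e e == 1). ring. }
    unfold inner. simpl. ring.
  - apply CRmult_le_compat_l. { apply CRabs_pos. }
    now apply dist_along_unit_le, rotate_unit.
Qed.

(** Some [direction theta] is parallel to [w] up to an error of [eps]. *)
Definition approximable (w : plane R) : Set := forall eps, 0 < eps ->
  { theta : CRcarrier R | CRabs R (inner w (rotate (direction theta))) <= eps }.

Section FromDirections.

Context (Hdir : forall theta, stabilizes (dyadic_length (dist_along (direction theta)) alpha)).

Lemma dist_le_along_axes v v' :
  dist v v' <= dist_along (CR_of_Q R 1, CR_of_Q R 0) v v'
    + dist_along (CR_of_Q R 0, CR_of_Q R 1) v v'.
Proof.
  set (a := dist_along (CR_of_Q R 1, CR_of_Q R 0) v v').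
  set (b := dist_along (CR_of_Q R 0, CR_of_Q R 1) v v').
  assert (Ha : 0 <= a) by apply CRabs_pos. assert (Hb : 0 <= b) by apply CRabs_pos.
  apply CRle_of_squares. { nonneg. }
  assert (Ea : a * a == (fst v - fst v') * (fst v - fst v')).
  { unfold a, dist_along. rewrite CRabs_square. unfold inner. simpl. ring. }
  assert (Eb : b * b == (snd v - snd v') * (snd v - snd v')).
  { unfold b, dist_along. rewrite CRabs_square. unfold inner. simpl. ring. }
  rewrite dist_sqr. unfold inner. simpl. rewrite <- Ea, <- Eb.
  certify (2 * (a * b)).
Qed.

(** The axes are approximable with the error [1/4] each. The resulting error of
    half the distance can be absorbed. *)
Lemma dyadic_length_dist_bounded :
  { K : CRcarrier R | 0 <= K /\ forall k, dyadic_length dist alpha k <= K }.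
Proof.
  assert (Hq : 0 < CR_of_Q R (1#4)) by (apply CR_of_Q_lt; reflexivity).
  destruct (direction_quadrant (CR_of_Q R 1) 0 _ ltac:(nonneg) ltac:(nonneg) Hq) as [s Hs].
  destruct (direction_quadrant (CR_of_Q R 0) 1 _ ltac:(nonneg) ltac:(nonneg) Hq) as [t Ht].
  set (rs := CRabs R (inner (CR_of_Q R 1, CR_of_Q R 0) (direction s))).
  set (rt := CRabs R (inner (CR_of_Q R 0, CR_of_Q R 1) (direction t))).
  assert (H : forall v v', dist v v'
    <= 2 * rs * dist_along (direction s) v v' + 2 * rt * dist_along (direction t) v v').
  { intros v v'. assert (H0 := dist_le_along_axes v v').
    assert (H1 := dist_along_rotate (CR_of_Q R 1, CR_of_Q R 0) _ v v' (direction_unit s)).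
    assert (H2 := dist_along_rotate (CR_of_Q R 0, CR_of_Q R 1) _ v v' (direction_unit t)).
    apply CRabs_def2, proj1 in H1. apply CRabs_def2, proj1 in H2. fold rs in H1. fold rt in H2.
    assert (Hd := dist_nonneg v v').
    set (gs := CRabs R (inner (CR_of_Q R 1, CR_of_Q R 0) (rotate (direction s)))) in *.
    set (gt := CRabs R (inner (CR_of_Q R 0, CR_of_Q R 1) (rotate (direction t)))) in *.
    set (a := dist_along (CR_of_Q R 1, CR_of_Q R 0) v v') in *.
    set (b := dist_along (CR_of_Q R 0, CR_of_Q R 1) v v') in *.
    certify (2 * (a + b - dist v v')
      + 2 * (gs * dist v v' - (a - rs * dist_along (direction s) v v'))
      + 2 * (gt * dist v v' - (b - rt * dist_along (direction t) v v'))
      + 2 * ((CR_of_Q R (1#4) - gs) * dist v v') + 2 * ((CR_of_Q R (1#4) - gt) * dist v v')). }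
  destruct (stabilizes_bounded _ (Hdir s)) as [Ks HKs].
  destruct (stabilizes_bounded _ (Hdir t)) as [Kt HKt].
  assert (HK : forall k, dyadic_length dist alpha k <= 2 * rs * Ks + 2 * rt * Kt).
  { intro k. apply (CRle_trans _ _ _ (dyadic_length_le _ _ alpha k H)).
    rewrite (dyadic_length_plus (fun v v' => 2 * rs * dist_along (direction s) v v')).
    rewrite (dyadic_length_scale (2 * rs) (dist_along (direction s))),
      (dyadic_length_scale (2 * rt) (dist_along (direction t))).
    assert (Hrs : 0 <= rs) by apply CRabs_pos. assert (Hrt : 0 <= rt) by apply CRabs_pos.
    apply CRplus_le_compat; apply CRmult_le_compat_l; try apply HKs; try apply HKt; nonneg. }
  exists (2 * rs * Ks + 2 * rt * Kt). split; [|exact HK].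
  apply (CRle_trans _ _ _ (dyadic_length_nonneg dist alpha 0 dist_nonneg)), HK.
Qed.

Lemma stabilizes_along_approximable w : approximable w ->
  stabilizes (dyadic_length (dist_along w) alpha).
Proof.
  intro Hw. destruct dyadic_length_dist_bounded as [K [HK0 HK]].
  apply stabilizes_uniform_limit. intros eps Heps.
  destruct (small_factor K eps HK0 Heps) as [d [Hd HdK]].
  destruct (Hw d Hd) as [t Ht].
  set (r := CRabs R (inner w (direction t))). set (e := direction t) in *.
  exists (fun k => r * dyadic_length (dist_along e) alpha k). split.
  { apply stabilizes_scale; [apply CRabs_pos | apply Hdir]. }
  intro k. set (g := CRabs R (inner w (rotate e))) in *.
  assert (Hg : 0 <= g) by apply CRabs_pos.
  assert (H : forall v v', CRabs R (dist_along w v v' - r * dist_along e v v') <= g * dist v v').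
  { intros. apply dist_along_rotate, direction_unit. }
  assert (H1 : dyadic_length (dist_along w) alpha k
    <= dyadic_length (fun v v' => r * dist_along e v v' + g * dist v v') alpha k).
  { apply dyadic_length_le. intros v v'. destruct (CRabs_def2 _ _ (H v v')) as [H1 _].
    certify (g * dist v v' - (dist_along w v v' - r * dist_along e v v')). }
  assert (H2 : dyadic_length (fun v v' => r * dist_along e v v') alpha k
    <= dyadic_length (fun v v' => dist_along w v v' + g * dist v v') alpha k).
  { apply dyadic_length_le. intros v v'. destruct (CRabs_def2 _ _ (H v v')) as [_ H2].
    certify (dist_along w v v' - r * dist_along e v v' - - (g * dist v v')). }
  rewrite (dyadic_length_plus (fun v v' => r * dist_along e v v')) in H1.
  rewrite (dyadic_length_plus (dist_along w)) in H2.
  rewrite (dyadic_length_scale r (dist_along e)), (dyadic_length_scale g dist) in H1.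
  rewrite (dyadic_length_scale r (dist_along e)), (dyadic_length_scale g dist) in H2.
  specialize (HK k).
  set (l := dyadic_length dist alpha k) in *.
  set (uw := dyadic_length (dist_along w) alpha k) in *.
  set (ue := dyadic_length (dist_along e) alpha k) in *.
  apply CRabs_le. split.
  - certify ((uw + g * l - r * ue) + g * (K - l) + (d - g) * K + (eps - d * K)).
  - certify ((r * ue + g * l - uw) + g * (K - l) + (d - g) * K + (eps - d * K)).
Qed.

Local Notation ex := (CR_of_Q R 1, CR_of_Q R 0).

Lemma approximable_frame p q : 0 <= p -> 0 <= q -> approximable (frame ex p q).
Proof.
  intros Hp Hq eps Heps. destruct (direction_quadrant p q eps Hp Hq Heps) as [t Ht].
  exists t. refine (CRle_trans _ _ _ _ Ht). apply CRle_of_eq, CRabs_morph.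
  unfold inner. simpl. ring.
Qed.

Lemma approximable_frame_opp p q : 0 <= p -> 0 <= q -> approximable (frame ex p (- q)).
Proof.
  intros Hp Hq eps Heps. destruct (direction_fourth_quadrant p q eps Hp Hq Heps) as [t Ht].
  exists t. refine (CRle_trans _ _ _ _ Ht). apply CRle_of_eq, CRabs_morph.
  unfold inner. simpl. ring.
Qed.

Lemma approximable_axis : approximable ex.
Proof.
  intros eps Heps.
  destruct (direction_quadrant (CR_of_Q R 1) 0 eps ltac:(nonneg) ltac:(nonneg) Heps) as [t Ht].
  now exists t.
Qed.

Lemma stabilizes_slanted m : stabilizes (dyadic_length (slanted_dist m ex) alpha).
Proof.
  set (u := fun w => dyadic_length (dist_along w) alpha).
  set (wp := fun i => frame ex (edge_x m i) (edge_y m i)).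
  set (wm := fun i => frame ex (edge_x m i) (- edge_y m i)).
  apply (stabilizes_ext (fun k => sum_below (fun i =>
    edge_scale m i * (u (wp i) k + u (wm i) k)) m)).
  { intro k. unfold slanted_dist. rewrite dyadic_length_sum_below.
    apply sum_below_ext. intros i _.
    symmetry. etransitivity.
    { apply (dyadic_length_scale (edge_scale m i)
        (fun v v' => dist_along (wp i) v v' + dist_along (wm i) v v')). }
    rewrite (dyadic_length_plus (dist_along (wp i))). reflexivity. }
  assert (Hnd : forall w, nondecreasing (u w)) by (intro; apply dist_along_length_nondecreasing).
  apply (stabilizes_sum_below (fun i k => edge_scale m i * (u (wp i) k + u (wm i) k))).
  - intros i _ k. assert (H := edge_scale_nonneg m i).
    assert (H1 := Hnd (wp i) k). assert (H2 := Hnd (wm i) k).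
    certify (edge_scale m i * ((u (wp i) (S k) - u (wp i) k) + (u (wm i) (S k) - u (wm i) k))).
  - intros i Hi. apply (stabilizes_scale _ (fun k => u (wp i) k + u (wm i) k)).
    { apply edge_scale_nonneg. }
    assert (Hx := edge_x_nonneg m i).
    assert (Hy := edge_y_nonneg m i ltac:(lia)).
    apply stabilizes_plus; try apply Hnd; apply stabilizes_along_approximable.
    + now apply approximable_frame.
    + now apply approximable_frame_opp.
Qed.

Lemma stabilizes_dist : stabilizes (dyadic_length dist alpha).
Proof.
  destruct dyadic_length_dist_bounded as [K [HK0 HK]].
  apply stabilizes_uniform_limit. intros eps Heps.
  destruct (archimedean_factor (2 * K) eps ltac:(nonneg) Heps) as [m Hm].
  set (u := dyadic_length (dist_along ex) alpha).
  set (g := dyadic_length (slanted_dist m ex) alpha).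
  exists (fun k => vertex_x m m * u k + g k). split.
  - assert (Hc := vertex_x_last_nonneg m).
    assert (Hu := dist_along_length_nondecreasing ex). fold u in Hu.
    apply (stabilizes_plus (fun k => vertex_x m m * u k)).
    + intro k. specialize (Hu k). certify (vertex_x m m * (u (S k) - u k)).
    + apply dyadic_length_nondecreasing, slanted_dist_triangular.
    + apply stabilizes_scale; [exact Hc|].
      apply stabilizes_along_approximable, approximable_axis.
    + apply stabilizes_slanted.
  - intro k. assert (He : unit_vector ex) by (unfold unit_vector, inner; simpl; ring).
    destruct (polygon_length_bounds m ex k He) as [H1 H2]. fold u g in H1, H2.
    specialize (HK k). set (l := dyadic_length dist alpha k) in *.
    rewrite CRabs_right by nonneg.
    apply (CRmult_le_reg_l (N m)). { apply INR_S_pos. }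
    apply (CRmult_le_reg_l (N m)). { apply INR_S_pos. }
    assert (HN : 1 <= N m).
    { apply (CRle_trans _ (INR 1)). { apply CRle_refl. } apply INR_le. lia. }
    assert (HN0 := INR_nonneg (S m)).
    certify ((2 * l - N m * N m * (l - (vertex_x m m * u k + g k))) + 2 * (K - l)
      + (N m * eps - 2 * K) + (N m - 1) * (N m * eps)).
Qed.

End FromDirections.

End Rectifiability.

End Proof.

Theorem theorem1 (R : ConstructiveReals) (alpha : unit_interval R -> plane R)
    (Halpha : is_path alpha) :
  iffT (rectifiable alpha) (finite_variation_in_every_direction alpha).
Proof.
  assert (Hdist := has_length_iff_dyadic dist alpha dist_pseudometric Halpha).
  assert (Hdir : forall theta, iffT (has_length (dist_along (direction theta)) alpha)
    (stabilizes (dyadic_length (dist_along (direction theta)) alpha))).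
  { intro theta. apply has_length_iff_dyadic.
    - apply dist_along_pseudometric.
    - apply dist_along_continuous; [apply direction_unit | exact Halpha]. }
  split.
  - intros Hl theta.
    destruct (snd (Hdir theta)) as [v Hv].
    { apply stabilizes_along_unit; [apply direction_unit | apply Hdist, Hl]. }
    exists v. now apply is_variation_iff.
  - intro Hv. apply Hdist, stabilizes_dist. intro theta. apply Hdir.
    destruct (Hv theta) as [v H]. exists v. now apply is_variation_iff.
Qed.
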